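(* Let $n\ge1$. For each $\alpha\in\mathbb{R}$ with $\alpha\neq 0$, there is a generic subset $\mathcal{M}$ of $\mathcal{S}^I_n$ such that, for every pair of systems $\sigma^o_1,\sigma^o_2\in\mathcal{M}$: $\sigma^o_1$ and $\sigma^o_2$ are i/o equivalent with respect to all inputs in $\mathcal{V}_\alpha$ if and only if $\sigma^o_1$ and $\sigma^o_2$ are i/o equivalent.
   Context: A 4-tuple of dimension $n$ is $(A,N,b,c)$ with $A,N\in\mathbb{R}^{n\times n}$, $b\in\mathbb{R}^{n\times 1}$, $c\in\mathbb{R}^{1\times n}$. The bilinear system of type I associated with it is $\dot x=(A+uN)x+bu$, $x(0)=0$, $y=cx$. The class $\mathcal{S}^{I}_n$ of all $n$-dimensional bilinear systems of type I is identified with $\mathbb{R}^{2n^2+2n}$ via 4-tuples. A subset of $\mathbb{R}^\ell$ is called generic if it is open and dense and its complement has Lebesgue measure zero. Inputs are Lebesgue-measurable, essentially bounded functions $u:[0,T_u]\to\mathbb{R}$; $\Omega$ is the set of all inputs. Two systems are i/o equivalent with respect to a set $\mathcal{U}\subseteq\Omega$ of inputs if for each $u\in\mathcal{U}$ the two outputs $y(t)$ coincide for all $t\in[0,T_u]$; they are i/o equivalent (no qualifier) if this holds with $\mathcal{U}=\Omega$. The pulse is $\mathbf{u}_{\tau,\alpha}(t)=\alpha$ for $0\le t<\tau$ and $\mathbf{u}_{\tau,\alpha}(t)=0$ for $t\ge\tau$, and $\mathcal{V}_\alpha=\{\mathbf{u}_{\tau,\alpha}\mid \tau\ge0\}$.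 Pulses may be viewed as defined on $[0,T]$ for any $T>\tau$; the choice of $T$ is immaterial, so equivalence under a pulse means that outputs coincide for all $t\ge 0$. *)

(* Defs.v *)
From HB Require Import structures.
From mathcomp Require Import all_boot all_order all_algebra.
From mathcomp Require Import all_classical all_reals all_analysis.

Set Implicit Arguments.
Unset Strict Implicit.
Unset Printing Implicit Defensive.

Import Order.TTheory GRing.Theory Num.Theory.
Import numFieldNormedType.Exports.

Local Open Scope classical_set_scope.
Local Open Scope ring_scope.

(* [lebesgue_measure] is defined on the Borel sets only.  Lebesgue measurability
   and Lebesgue integration refer to its completion, whose sigma-algebra is
   carried by this alias of R. *)
Notation lebesgue_line R :=
  (caratheodory_type ((wlength (idfun : R -> R))^*)%mu).

Definition leb (R : realType) : {measure set (lebesgue_line R) -> \bar R} :=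
  @completed_lebesgue_measure R.

(* Lebesgue outer measure of a subset of R^l: infimum of the total volumes of
   the countable covers by boxes. *)

Definition box (R : realType) (l : nat) (a b : 'rV[R]_l) : set 'rV[R]_l :=
  [set x | forall i, a 0 i <= x 0 i <= b 0 i].

Definition box_volume (R : realType) (l : nat) (a b : 'rV[R]_l) : R :=
  \prod_(i < l) (b 0 i - a 0 i).

Definition box_cover (R : realType) (l : nat) (X : set 'rV[R]_l)
    (a b : nat -> 'rV[R]_l) : Prop :=
  (forall k i, a k 0 i <= b k 0 i) /\ X `<=` \bigcup_k box (a k) (b k).

Definition lebesgue_outer (R : realType) (l : nat) (X : set 'rV[R]_l) :
    \bar R :=
  ereal_inf [set v | exists a b : nat -> 'rV[R]_l, box_cover X a b /\
    v = (\sum_(0 <= k <oo) (box_volume (a k) (b k))%:E)%E].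

Definition generic (R : realType) (l : nat) (X : set 'rV[R]_l) : Prop :=
  [/\ open X, dense X & lebesgue_outer (~` X) = 0%E].

(* A 4-tuple (A, N, b, c), i.e. the system
     x' = (A + u N) x + b u,  x(0) = 0,  y = c x. *)
Record bilinear_sys (R : realType) (n : nat) := BilinearSys {
  sysA : 'M[R]_n;
  sysN : 'M[R]_n;
  sysb : 'cV[R]_n;
  sysc : 'rV[R]_n }.

(* The identification of the class of n-dimensional systems with
   R^(2 n^2 + 2 n). *)
Definition sys_coords (R : realType) (n : nat) (s : bilinear_sys R n) :
    'rV[R]_((n * n + n * n) + (n + n)) :=
  row_mx (row_mx (mxvec (sysA s)) (mxvec (sysN s)))
         (row_mx (sysb s)^T (sysc s)).

Definition generic_sys (R : realType) (n : nat) (M : set (bilinear_sys R n)) :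
    Prop :=
  generic (@sys_coords R n @` M).

(* A signal (T, u) stands for the restriction of u to [0, T]. *)
Notation signal R := (R * (R -> R))%type.

(* The set Omega of all inputs. *)
Definition inputs (R : realType) : set (signal R) :=
  [set u | [/\ 0 <= u.1,
    measurable_fun (`[0, u.1] : set (lebesgue_line R))
      (u.2 : lebesgue_line R -> R) &
    exists K : R, \forall t \ae leb R, t \in `[0, u.1] -> `|u.2 t| <= K]].

(* Caratheodory solution on [0, T], in integral form.  For (T, u) in [inputs]
   and x continuous the integrands are bounded and measurable. *)
Definition is_state (R : realType) (n : nat) (s : bilinear_sys R n)
    (u : signal R) (x : R -> 'cV[R]_n) : Prop :=
  {within `[0, u.1], continuous x} /\
  forall t : R, t \in `[0, u.1] -> forall i,
    x t i 0 = \int[leb R]_(r in `[0, t])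
      ((sysA s + u.2 r *: sysN s) *m x r + u.2 r *: sysb s) i 0.

(* For (T, u) in [inputs] the solution exists and is unique on [0, T];
   [xget] selects it, and its values outside [0, T] are never used. *)
Definition state (R : realType) (n : nat) (s : bilinear_sys R n)
    (u : signal R) : R -> 'cV[R]_n :=
  xget (fun=> 0) [set x | is_state s u x].

Definition output (R : realType) (n : nat) (s : bilinear_sys R n)
    (u : signal R) (t : R) : R :=
  (sysc s *m state s u t) 0 0.

Definition io_equiv_wrt (R : realType) (n : nat) (U : set (signal R))
    (s1 s2 : bilinear_sys R n) : Prop :=
  forall u, U u -> forall t : R, t \in `[0, u.1] -> output s1 u t = output s2 u t.

Definition io_equiv (R : realType) (n : nat) (s1 s2 : bilinear_sys R n) :
    Prop :=
  io_equiv_wrt (@inputs R) s1 s2.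

Definition pulse (R : realType) (tau alpha t : R) : R :=
  if 0 <= t < tau then alpha else 0.

(* V_alpha: every pulse, on every interval [0, T] with T > tau, so that
   equivalence with respect to [pulses alpha] compares outputs for all t >= 0. *)
Definition pulses (R : realType) (alpha : R) : set (signal R) :=
  [set u | exists2 tau : R, 0 <= tau < u.1 & u.2 = pulse tau alpha].

(* Main.v *)
Require Import Defs.
From mathcomp Require Import all_boot all_order all_algebra perm.
From mathcomp Require Import all_classical all_reals all_analysis.
From mathcomp Require Import measurable_realfun.
From mathcomp Require Import zify ring lra.

Set Implicit Arguments.
Unset Strict Implicit.
Unset Printing Implicit Defensive.

Import Order.TTheory GRing.Theory Num.Theory.
Import numFieldNormedType.Exports.

Local Open Scope classical_set_scope.
Local Open Scope ring_scope.

(** For a system driven by a constant input [alpha] up to time [tau] and then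
    left free, the state solves an affine equation with matrix
    [F = A + alpha N] and then a linear one with matrix [A].  Hence the
    response to the pulse of length [tau], read [r] units of time after the
    pulse stops, is an entire function of [(tau, r)] whose Taylor coefficients
    are, up to the factor [alpha], the numbers [c A^i F^j b].  Two systems
    with the same responses to all pulses of height [alpha] therefore share
    these numbers ([pulse_equiv_moments]).

    When [(A, c)] is observable and [(F, b)] is controllable, the numbers
    [c A^i F^j b] determine the system up to a change of basis of the state
    space: the factorization of the matrix [c A^i F^j b] into the observability
    and the controllability matrix is unique up to an invertible [T], and the
    shifted matrices [c A^i A F^j b] and [c A^i F F^j b] show that [T]
    intertwines the [A]'s and the [F]'s, hence the [N]'s
    ([realization_unique]).  Systems related by such a [T] are equivalent for
    every input because [T] carries solutions to solutions and solutions are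
    unique ([state_unique], a Gronwall argument in the norm weighted by
    [expR (- 2 * L * t)]).

    The systems satisfying the two rank conditions are the points where a
    polynomial [min_det] does not vanish ([generic_minimal_sys]).  The
    polynomial is homogeneous in the coordinates, so on every line parallel to
    a fixed vector [v] with [min_det v != 0] it is a nonzero univariate
    polynomial of bounded degree.  This gives density at once, and also that
    the zero set is null: many translates of it along [v] cover no point more
    than a bounded number of times, so that, counted in cells of a fine grid,
    each bounded piece of it is negligible ([grid_count]). *)

(** * Lebesgue integration on the completed line *)

Lemma measurable_leb (R : realType) (A : set (measurableTypeR R)) :
  measurable A -> measurable (A : set (lebesgue_line R)).
Proof. by move=> mA; exact: sub_caratheodory. Qed.

Lemma measurable_fun_leb (R : realType) (D : set (measurableTypeR R)) (f : R -> R) :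
  measurable D ->
  measurable_fun D (f : measurableTypeR R -> R) ->
  measurable_fun (D : set (lebesgue_line R)) (f : lebesgue_line R -> R).
Proof.
by move=> mD mf _ A mA; apply: measurable_leb; exact: mf.
Qed.

(** The identity from the completed line to the Borel line is measurable and
    pushes [leb] forward to the Borel measure, so the theorems on the integral
    for [lebesgue_measure] apply to [leb] on Borel functions. *)
Lemma integral_leb (R : realType) (D : set (measurableTypeR R)) (f : R -> R) :
  measurable D -> measurable_fun D (f : measurableTypeR R -> R) ->
  (\int[leb R]_(r in D) (f r)%:E = \int[lebesgue_measure]_(r in D) (f r)%:E)%E.
Proof.
move=> mD mf.
have mid : measurable_fun setT (idfun : lebesgue_line R -> measurableTypeR R).
  by move=> _ A mA; rewrite setTI; exact: measurable_leb.
have tr (h : R -> \bar R) : @measurable_fun _ _ (measurableTypeR R) _ D h ->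
    (forall r, 0 <= h r)%E ->
    (\int[leb R]_(r in D) h r = \int[lebesgue_measure]_(r in D) h r)%E.
  move=> mh h0; have := @ge0_integral_pushforward _ _ _ _ R _ mid (leb R) D h mD mh.
  move=> /(_ (fun r _ => h0 r)) /= <-.
  by apply: eq_measure_integral.
rewrite [LHS]integralE [RHS]integralE; congr (_ - _)%E; apply: tr => //.
- exact/measurable_funepos/measurable_EFinP.
- exact/measurable_funeneg/measurable_EFinP.
Qed.

Lemma measurable_itv_leb (R : realType) (i : interval R) :
  measurable ([set` i] : set (lebesgue_line R)).
Proof. exact: measurable_leb. Qed.

Lemma leb_segment (R : realType) (a b : R) : a <= b ->
  leb R [set` `[a, b]] = (b - a)%:E.
Proof.
move=> ab; change (leb R _) with (lebesgue_measure ([set` `[a, b]] : set R)).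
rewrite lebesgue_measure_itv /= lte_fin; move: ab.
rewrite le_eqVlt => /predU1P[->|->]; last by rewrite EFinB.
by rewrite ltxx subrr.
Qed.

Lemma continuous_segment_measurable (R : realType) (f : R -> R) (a b : R) :
  {within `[a, b], continuous f} ->
  measurable_fun `[a, b] (f : measurableTypeR R -> R).
Proof. by move=> cf; apply: subspace_continuous_measurable_fun. Qed.

Lemma leb_FTC (R : realType) (F f : R -> R) (a b : R) : a <= b ->
  (forall x : R, is_derive x (1 : R) F (f x)) -> continuous f ->
  \int[leb R]_(r in `[a, b]) f r = F b - F a.
Proof.
move=> ab dF cf; rewrite /Rintegral.
have cF : continuous F.
  by move=> x; apply/differentiable_continuous/derivable1_diffP/ex_derive.
have cfw : {within `[a, b], continuous f} by exact: continuous_subspaceT.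
rewrite integral_leb //; last exact: continuous_segment_measurable.
move: ab; rewrite le_eqVlt => /predU1P[<-|ab].
  by rewrite set_itv1 integral_set1 subrr.
rewrite (@continuous_FTC2 R f F a b) //.
  split; first by move=> x _; exact: ex_derive.
  - exact/cvg_at_right_filter/cF.
  - exact/cvg_at_left_filter/cF.
by move=> x _; rewrite derive1E; exact: derive_val.
Qed.

Lemma leb_ae_filter (R : realType) : Filter (nbhs (almost_everywhere (leb R))).
Proof. exact: (ae_filter_ringOfSetsType (leb R)). Qed.

Lemma continuous_segment_bounded (R : realType) (f : R -> R) (a b : R) :
  {within `[a, b], continuous f} ->
  exists2 K : R, 0 <= K & forall r, r \in `[a, b] -> `|f r| <= K.
Proof.
move=> cf; case: (leP a b) => [ab|ba]; last first.
  exists 0 => // r; rewrite in_itv /= => /andP[ar rb].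
  by have := lt_le_trans ba (le_trans ar rb); rewrite ltxx.
have cn : {within `[a, b], continuous (fun r => `|f r|)}.
  by move=> x; apply: continuous_comp; [exact: cf|exact: norm_continuous].
have [c _ hc] := EVT_max ab cn.
by exists `|f c|.
Qed.

Lemma segment_subl (R : realType) (T t : R) : t \in `[0, T] ->
  `[0, t]%classic `<=` `[0, T]%classic.
Proof.
rewrite in_itv /= => /andP[_ tT]; apply: subset_itvl.
by rewrite bnd_simp.
Qed.

(** [f + u * g] is the shape of the right-hand side of the state equation along
    a continuous path; it is essentially bounded on a bounded interval. *)
Lemma integrable_input (R : realType) (u : signal R) (f g : R -> R) (t : R) :
  inputs u -> t \in `[0, u.1] ->
  {within `[0, u.1], continuous f} -> {within `[0, u.1], continuous g} ->
  (leb R).-integrable `[0, t] (EFin \o (fun r => f r + u.2 r * g r)).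
Proof.
move=> [T0 mu [K hK]] tT cf cg; have t0 : 0 <= t by move/itvP: tT => ->.
have [Kf Kf0 hf] := continuous_segment_bounded cf.
have [Kg Kg0 hg] := continuous_segment_bounded cg.
have mt : measurable (`[0, t]%classic : set (lebesgue_line R)).
  exact: measurable_itv_leb.
have sub := segment_subl tT.
have mc (h : R -> R) : {within `[0, u.1], continuous h} ->
    measurable_fun (`[0, t]%classic : set (lebesgue_line R)) (h : lebesgue_line R -> R).
  move=> ch; apply: (measurable_funS (measurable_itv_leb `[0, u.1]) sub).
  apply: measurable_fun_leb => //; exact: continuous_segment_measurable.
have mu' : measurable_fun (`[0, t]%classic : set (lebesgue_line R))
    (u.2 : lebesgue_line R -> R).
  exact: (measurable_funS (measurable_itv_leb `[0, u.1]) sub).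
have mint : measurable_fun (`[0, t]%classic : set (lebesgue_line R))
    ((fun r => f r + u.2 r * g r) : lebesgue_line R -> R).
  by apply: measurable_funD; [exact: mc|apply: measurable_funM => //; exact: mc].
apply/integrableP; split; first exact/measurable_EFinP.
pose C := Kf + `|K| * Kg.
have C0 : 0 <= C by rewrite addr_ge0 // mulr_ge0.
have hle : (\int[leb R]_(r in `[0%R, t]) `|(f r + u.2 r * g r)%:E| <=
    \int[leb R]_(r in `[0%R, t]) cst C%:E r)%E.
  apply: ae_ge0_le_integral => //.
  - by apply: measurableT_comp => //; exact/measurable_EFinP.
  - apply: (@filterS _ _ (leb_ae_filter R) _ _ _ hK) => r hr rt /=; rewrite lee_fin.
    have rT : r \in `[0, u.1] by exact: sub.
    rewrite (le_trans (ler_normD _ _)) // lerD //; first exact: hf.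
    rewrite normrM ler_pM //; last exact: hg.
    by rewrite (le_trans (hr rT)) // ler_norm.
apply: (le_lt_trans hle).
by rewrite (integral_cst (leb R) mt) leb_segment // -EFinM ltry.
Qed.

Lemma continuous_leb_integrable (R : realType) (f : R -> R) (a b : R) : a <= b ->
  continuous f -> (leb R).-integrable `[a, b] (EFin \o f).
Proof.
move=> ab cf; have cfw : {within `[a, b], continuous f} by exact: continuous_subspaceT.
have [K K0 hK] := continuous_segment_bounded cfw.
apply: measurable_bounded_integrable.
- exact: measurable_itv_leb.
- by rewrite leb_segment // ltry.
- by apply: measurable_fun_leb => //; exact: continuous_segment_measurable.
exists K; split; first exact: num_real.
by move=> M KM r rt; apply: le_trans (hK r rt) (ltW KM).
Qed.

Lemma le_Rintegral_ae (R : realType) (f G : R -> R) (t : R) :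
  0 <= t -> (leb R).-integrable `[0, t] (EFin \o f) -> continuous G ->
  (\forall r \ae leb R, r \in `[0, t] -> `|f r| <= G r) ->
  (forall r, 0 <= G r) ->
  `|\int[leb R]_(r in `[0, t]) f r| <= \int[leb R]_(r in `[0, t]) G r.
Proof.
move=> t0 iF cG hle G0.
have mt : measurable (`[0, t]%classic : set (lebesgue_line R)).
  exact: measurable_itv_leb.
apply: (le_trans (le_normr_Rintegral mt iF)).
have iG := continuous_leb_integrable t0 cG.
have /integrableP[/measurable_EFinP mG _] := iG.
rewrite /Rintegral fine_le //.
- exact: integrable_fin_num (integrable_norm iF).
- exact: integrable_fin_num.
apply: ae_ge0_le_integral => //.
- apply/measurable_EFinP.
  by have /integrableP[/measurable_EFinP + _] := iF; exact: measurableT_comp.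
- by move=> r _; rewrite lee_fin.
- exact/measurable_EFinP.
Qed.

(** * Continuity of matrix-valued maps *)

Section matrix_continuity.
Context (R : realType) (T : topologicalType).

Lemma continuous_mx_entries m p (f : T -> 'M[R]_(m, p)) :
  (forall i j, continuous (fun x => f x i j)) -> continuous f.
Proof.
move=> fM x A [P PM PA].
have : \forall z \near x, forall i j, P i j (f z i j).
  by apply: filter_forall => i; apply: filter_forall => j; exact/fM/PM.
by apply: filterS => z Pz; exact: PA.
Qed.

Lemma coord_comp_continuous m p (f : T -> 'M[R]_(m, p)) i j :
  continuous f -> continuous (fun x => f x i j).
Proof.
move=> cf x; apply: (@continuous_comp _ _ _ f (fun M : 'M[R]_(m, p) => M i j)).
  exact: cf.
exact: coord_continuous.
Qed.

Lemma continuous_sum (I : Type) (r : seq I) (P : pred I) (f : I -> T -> R) :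
  (forall i, continuous (f i)) -> continuous (fun x => \sum_(i <- r | P i) f i x).
Proof.
move=> cf; apply: continuous_big; first by move=> z; exact: add_continuous.
by move=> i _; exact: cf.
Qed.

Lemma continuous_mulmx m p q (f : T -> 'M[R]_(m, p)) (g : T -> 'M[R]_(p, q)) :
  continuous f -> continuous g -> continuous (fun x => f x *m g x).
Proof.
move=> cf cg; apply: continuous_mx_entries => i j.
rewrite (_ : (fun x => _) = (fun x => \sum_k f x i k * g x k j)); last first.
  by apply/funext => x; rewrite mxE.
apply: continuous_sum => k x; apply: cvgM.
  exact: (coord_comp_continuous (i := i) (j := k) cf).
exact: (coord_comp_continuous (i := k) (j := j) cg).
Qed.

Lemma continuous_expmx p (f : T -> 'M[R]_p) k :
  continuous f -> continuous (fun x => f x ^+ k).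
Proof.
move=> cf; elim: k => [|k IHk].
  rewrite (_ : (fun x => _) = (fun=> 1)); first by move=> x; exact: cvg_cst.
  by apply/funext => x; rewrite expr0.
rewrite (_ : (fun x => _) = (fun x => f x *m f x ^+ k)); last first.
  by apply/funext => x; rewrite exprS.
exact: continuous_mulmx.
Qed.

Lemma continuous_det p (f : T -> 'M[R]_p) :
  continuous f -> continuous (fun x => \det (f x)).
Proof.
move=> cf; apply: continuous_sum => s x; apply: cvgM; first exact: cvg_cst.
move: x; apply: continuous_big; first exact: mul_continuous.
by move=> i _; exact: (coord_comp_continuous (i := i) (j := s i) cf).
Qed.

Lemma continuous_addZ p q (f g : T -> 'M[R]_(p, q)) a :
  continuous f -> continuous g -> continuous (fun x => f x + a *: g x).
Proof.
move=> cf cg; apply: continuous_mx_entries => i j.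
rewrite (_ : (fun x => _) = (fun x => f x i j + a * g x i j)); last first.
  by apply/funext => x; rewrite !mxE.
have cfij := @coord_comp_continuous _ _ _ i j cf.
have cgij := @coord_comp_continuous _ _ _ i j cg.
by move=> x; apply: cvgD; [exact: cfij|apply: cvgMl_tmp; exact: cgij].
Qed.

Lemma continuous_mulfun (f g : T -> R) :
  continuous f -> continuous g -> continuous (fun x => f x * g x).
Proof. by move=> cf cg x; apply: cvgM; [exact: cf|exact: cg]. Qed.

End matrix_continuity.

(** * Uniqueness of states *)

Section states.
Context (R : realType) (n : nat).
Implicit Types (s : bilinear_sys R n) (u : signal R) (x : R -> 'cV[R]_n).

(** The right-hand side of the state equation along the path [x]. *)
Definition vfield s (u : signal R) x (r : R) : 'cV[R]_n :=
  (sysA s + u.2 r *: sysN s) *m x r + u.2 r *: sysb s.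

Lemma vfieldE s u x r i : vfield s u x r i 0 =
  (sysA s *m x r) i 0 + u.2 r * (sysN s *m x r + sysb s) i 0.
Proof.
rewrite /vfield mulmxDl -scalemxAl -addrA -scalerDr mxE.
by congr (_ + _); rewrite mxE.
Qed.

Lemma vfield_integrable s u x t i : inputs u -> t \in `[0, u.1] ->
  {within `[0, u.1], continuous x} ->
  (leb R).-integrable `[0, t] (EFin \o (fun r => vfield s u x r i 0)).
Proof.
move=> uin tT cx.
rewrite (_ : (fun r => vfield s u x r i 0) = (fun r => (sysA s *m x r) i 0 +
    u.2 r * (sysN s *m x r + sysb s) i 0)); last first.
  by apply/funext => r; exact: vfieldE.
apply: (@integrable_input R u (fun r => (sysA s *m x r) i 0)
  (fun r => (sysN s *m x r + sysb s) i 0)) => //.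
  apply: (@coord_comp_continuous R (subspace _) n 1 (fun r => sysA s *m x r)).
  apply: (@continuous_mulmx R (subspace _)) => //; exact: cst_continuous.
rewrite (_ : (fun _ => _) = (fun r => (sysN s *m x r) i 0 + sysb s i 0)); last first.
  by apply/funext => r; rewrite mxE.
move=> r; apply: cvgD; last exact: cvg_cst.
apply: (@coord_comp_continuous R (subspace _) n 1 (fun r => sysN s *m x r)).
apply: (@continuous_mulmx R (subspace _)) => //; exact: cst_continuous.
Qed.

Lemma eq0_halving (a b : R) : (forall k, `|a| <= b / 2 ^+ k) -> a = 0.
Proof.
move=> h; apply/eqP; apply: contraT => a0.
have a1 : 0 < `|a| by rewrite normr_gt0.
have b0 : 0 <= b / `|a|.
  by rewrite divr_ge0 //; have := h 0; rewrite expr0 divr1; exact: le_trans.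
have := h (Num.bound (b / `|a|)).
rewrite ler_pdivlMr ?exprn_gt0 // mulrC -ler_pdivlMr // => hb.
have := lt_le_trans (archi_boundP b0) (le_trans _ hb).
rewrite ltxx; apply.
by rewrite -natrX ler_nat ltnW // ltn_expl.
Qed.

(** The difference [d] of two solutions satisfies
    [|d t| <= L * \int_0^t max |d|], with [L] a bound for the norm of
    [A + u N].  Therefore a bound [m * expR (2 * L * t)] for [d] improves to
    [m / 2 * expR (2 * L * t)], and repeating this kills [d]. *)
Lemma state_unique s u x y : inputs u -> is_state s u x -> is_state s u y ->
  forall t, t \in `[0, u.1] -> x t = y t.
Proof.
move=> uin [cx hx] [cy hy]; have [T0 _ [K hK]] := uin.
pose d t i := x t i 0 - y t i 0.
pose L : R := \sum_i \sum_j (`|sysA s i j| + `|K| * `|sysN s i j|) + 1.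
have sum0 : 0 <= \sum_i \sum_j (`|sysA s i j| + `|K| * `|sysN s i j|).
  by apply: sumr_ge0 => i _; apply: sumr_ge0 => j _; rewrite addr_ge0 // mulr_ge0.
have L0 : 0 < L by rewrite ltr_wpDl.
have dE (t : R) : t \in `[0, u.1] -> forall i, d t i =
    \int[leb R]_(r in `[0, t]) (vfield s u x r i 0 - vfield s u y r i 0).
  move=> tT i; rewrite /d (hx t tT) (hy t tT) RintegralB //.
  - exact: measurable_itv_leb.
  - exact: vfield_integrable.
  - exact: vfield_integrable.
have lip r (D : R) : `|u.2 r| <= K -> 0 <= D -> (forall j, `|d r j| <= D) ->
    forall i, `|vfield s u x r i 0 - vfield s u y r i 0| <= L * D.
  move=> uK D0 dD i; rewrite !vfieldE.
  rewrite (_ : _ - _ = \sum_j (sysA s i j + u.2 r * sysN s i j) * d r j); last first.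
    rewrite ![(_ + sysb s) _ _]mxE ![(_ *m _) _ _]mxE.
    rewrite [RHS](eq_bigr (fun j => (sysA s i j * x r j 0 - sysA s i j * y r j 0) +
      u.2 r * (sysN s i j * x r j 0 - sysN s i j * y r j 0))); last first.
      by move=> j _; rewrite /d; ring.
    by rewrite big_split /= -mulr_sumr !sumrB; ring.
  apply: (le_trans (ler_norm_sum _ _ _)).
  apply: (@le_trans _ _ (\sum_j (`|sysA s i j| + `|K| * `|sysN s i j|) * D)).
    apply: ler_sum => j _; rewrite normrM ler_pM //.
    rewrite (le_trans (ler_normD _ _)) // lerD // normrM ler_wpM2r //.
    exact: le_trans uK (ler_norm _).
  rewrite -mulr_suml ler_wpM2r // /L [X in _ <= X + 1](bigD1 i) //= -addrA lerDl addr_ge0 //.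
  by apply: sumr_ge0 => k _; apply: sumr_ge0 => j _; rewrite addr_ge0 // mulr_ge0.
have step (m : R) : 0 <= m ->
    (forall t : R, t \in `[0, u.1] -> forall i, `|d t i| <= m * expR (2 * L * t)) ->
    (forall t : R, t \in `[0, u.1] -> forall i, `|d t i| <= m / 2 * expR (2 * L * t)).
  move=> m0 hm t tT i; rewrite dE //.
  have t0 : 0 <= t by move/itvP: tT => ->.
  (* the weight is chosen with rate [2 * L] so that [L] times its primitive
     is half of it *)
  pose G (r : R) : R := L * (m * expR (2 * L * r)).
  have dF (r : R) : is_derive r (1 : R) (fun r : R => m / 2 * expR (2 * L * r)) (G r).
    apply: is_derive_eq; rewrite /G /GRing.scale /=.
    by field.
  have cG : continuous G.
    rewrite /G => z; apply: cvgMl_tmp; apply: cvgMl_tmp.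
    apply: (@continuous_comp _ _ _ (fun r : R => 2 * L * r) expR).
      by apply: cvgMl_tmp; exact: cvg_id.
    exact: continuous_expR.
  have hle : `|\int[leb R]_(r in `[0, t]) (vfield s u x r i 0 - vfield s u y r i 0)| <=
      \int[leb R]_(r in `[0, t]) G r.
    apply: le_Rintegral_ae => //.
    - have := vfield_integrable s i uin tT cx.
      have := vfield_integrable s i uin tT cy.
      move=> iy ix; have := integrableB (measurable_itv_leb `[0, t]) ix iy.
      by apply: eq_integrable => //; exact: measurable_itv_leb.
    - apply: (@filterS _ _ (leb_ae_filter R) _ _ _ hK) => z hr zt.
      have zT : z \in `[0, u.1] by exact: (segment_subl tT).
      apply: lip; [exact: hr| |exact: hm].
      by rewrite mulr_ge0 // expR_ge0.
    - by move=> z; rewrite /G !mulr_ge0 ?expR_ge0 // ltW.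
  apply: (le_trans hle); rewrite (leb_FTC t0 dF cG) mulr0 expR0 mulr1 gerBl divr_ge0 //.
have [m0 m00 hm0] : exists2 m, 0 <= m &
    forall t : R, t \in `[0, u.1] -> forall i, `|d t i| <= m * expR (2 * L * t).
  have : forall i, exists Ki, 0 <= Ki /\ forall t, t \in `[0, u.1] -> `|d t i| <= Ki.
    move=> i; have cd : {within `[0, u.1], continuous (fun t => d t i)}.
      by move=> t; apply: cvgB; [move: t|move: t];
        apply: coord_comp_continuous.
    have [Ki Ki0 hKi] := continuous_segment_bounded cd.
    by exists Ki.
  move=> /boolp.choice[Kf hKf]; exists (\sum_i Kf i).
    by apply: sumr_ge0 => i _; case: (hKf i).
  move=> t tT i; rewrite (le_trans ((hKf i).2 t tT)) //.
  have tt0 : 0 <= t by move/itvP: tT => ->.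
  have e1 : 1 <= expR (2 * L * t).
    by rewrite -expR0 ler_expR !mulr_ge0 // ltW.
  rewrite -[Kf i]mulr1 ler_pM //; first by case: (hKf i).
  rewrite (bigD1 i) //= lerDl; apply: sumr_ge0 => j _; by case: (hKf j).
move=> t tT; apply/colP => i; apply/eqP; rewrite -subr_eq0; apply/eqP.
apply: (@eq0_halving _ (m0 * expR (2 * L * t))) => k; rewrite mulrAC.
rewrite -/(d t i); elim: k t tT i => [|k IHk] t tT i.
  by rewrite expr0 divr1; exact: hm0.
rewrite exprSr invfM mulrA; apply: step => //.
by rewrite divr_ge0 // exprn_ge0.
Qed.
End states.

(** * Similar systems *)

Section similarity.
Context (R : realType) (n : nat).
Implicit Types (s : bilinear_sys R n) (u : signal R).

Lemma state_eq s u x : inputs u -> is_state s u x ->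
  forall t, t \in `[0, u.1] -> state s u t = x t.
Proof.
move=> uin sx; apply: (state_unique uin _ sx).
by rewrite /state; apply: (@xgetPex _ _ [set x | is_state s u x]); exists x.
Qed.

Lemma Rintegral_lincomb d (T : measurableType d) (mu : {measure set T -> \bar R})
    (D : set T) (I : Type) (r : seq I) (a : I -> R) (f : I -> T -> R) :
  measurable D -> (forall i, mu.-integrable D (EFin \o f i)) ->
  mu.-integrable D (EFin \o (fun x => \sum_(i <- r) a i * f i x)) /\
  \int[mu]_(x in D) (\sum_(i <- r) a i * f i x) =
    \sum_(i <- r) a i * \int[mu]_(x in D) f i x.
Proof.
move=> mD hf; elim: r => [|i r [IHi IHe]].
  rewrite big_nil (_ : (fun x => _) = cst 0); last first.
    by apply/funext => x; rewrite big_nil.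
  by split; [exact: integrable0|rewrite Rintegral_cst // mul0r].
rewrite big_cons (_ : (fun x => _) =
  (fun x => a i * f i x + \sum_(j <- r) a j * f j x)); last first.
  by apply/funext => x; rewrite big_cons.
have hai : mu.-integrable D (EFin \o (fun x => a i * f i x)).
  have := integrableZl mD (a i) (hf i).
  by apply: eq_integrable => // x _; rewrite /= EFinM.
split.
  have := integrableD mD hai IHi.
  by apply: eq_integrable.
by rewrite RintegralD // IHe RintegralZl.
Qed.

Definition similar (T : 'M[R]_n) s1 s2 :=
  [/\ T *m sysA s1 = sysA s2 *m T, T *m sysN s1 = sysN s2 *m T,
      sysb s2 = T *m sysb s1 & sysc s1 = sysc s2 *m T].

Lemma is_state_similar T s1 s2 u x : similar T s1 s2 -> inputs u ->
  is_state s1 u x -> is_state s2 u (fun t => T *m x t).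
Proof.
move=> [hA hN hb _] uin [cx hx]; split.
  by apply: (@continuous_mulmx R (subspace _)) => //; exact: cst_continuous.
move=> t tT i; rewrite mxE.
under eq_bigr do rewrite (hx t tT).
have hi j := vfield_integrable s1 j uin tT cx.
have [_ <-] := Rintegral_lincomb (index_enum _) (fun j => T i j)
  (measurable_itv_leb `[0, t]) hi.
apply: eq_Rintegral => r _.
have -> : (sysA s2 + u.2 r *: sysN s2) *m (T *m x r) + u.2 r *: sysb s2 =
  T *m vfield s1 u x r.
  rewrite /vfield hb mulmxDr -scalemxAr; congr (_ + _).
  by rewrite !mulmxA mulmxDl mulmxDr -scalemxAl -scalemxAr hA hN.
by rewrite mxE.
Qed.

(** The change of basis carries the solutions of either system to those of the
    other.  So if one of them has no solution then neither has the other, and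
    both states are the default value [0] of [state]. *)
Lemma similar_io_equiv T s1 s2 : T \in unitmx -> similar T s1 s2 ->
  io_equiv s1 s2.
Proof.
move=> uT sT u uin t tT.
have [x1|nx1] := pselect (exists x, is_state s1 u x).
  have [x sx] := x1.
  rewrite /output (state_eq uin sx tT).
  rewrite (state_eq uin (is_state_similar sT uin sx) tT).
  by have [_ _ _ hc] := sT; rewrite hc -mulmxA.
have nx2 : ~ exists x, is_state s2 u x.
  move=> [y sy]; apply: nx1; exists (fun t => invmx T *m y t).
  apply: (is_state_similar _ uin sy); have [hA hN hb hc] := sT.
  split.
  - by rewrite -[sysA s2](mulmxK uT) -hA -mulmxA mulKmx.
  - by rewrite -[sysN s2](mulmxK uT) -hN -mulmxA mulKmx.
  - by rewrite hb mulKmx.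
  - by rewrite hc mulmxK.
rewrite /output /state !xgetPN ?mulmx0 // => x sx.
- by apply: nx2; exists x.
- by apply: nx1; exists x.
Qed.
End similarity.

(** * Exponential generating functions *)

Section egf.
Context {R : realType}.
Implicit Types (a b : nat -> R) (t : R).

Definition egf a t : R := limn (pseries (fun k => a k / k`!%:R) t).

(** Geometric growth makes [egf a] entire, and is stable under the shift of
    [a], which is the derivative of [egf a]. *)
Definition exp_bounded a := exists C r,
  [/\ 0 <= C, 0 <= r & forall k, `|a k| <= C * r ^+ k].

Lemma exp_bounded_shift a : exp_bounded a -> exp_bounded (fun k => a k.+1).
Proof.
move=> [C [r [C0 r0 h]]]; exists (C * r), r; split => //; first exact: mulr_ge0.
by move=> k; rewrite -mulrA -exprS.
Qed.

Lemma exp_boundedD a b : exp_bounded a -> exp_bounded b ->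
  exp_bounded (fun k => a k + b k).
Proof.
move=> [C [r [C0 r0 h]]] [D [q [D0 q0 g]]].
exists (C + D), (r + q); split; rewrite ?addr_ge0 // => k.
rewrite (le_trans (ler_normD _ _)) // mulrDl lerD //.
- apply: (le_trans (h k)); rewrite ler_wpM2l // lerXn2r ?nnegrE ?addr_ge0 //.
  by rewrite lerDl.
- apply: (le_trans (g k)); rewrite ler_wpM2l // lerXn2r ?nnegrE ?addr_ge0 //.
  by rewrite lerDr.
Qed.

Lemma exp_boundedZ c a : exp_bounded a -> exp_bounded (fun k => c * a k).
Proof.
move=> [C [r [C0 r0 h]]]; exists (`|c| * C), r; split; rewrite ?mulr_ge0 //.
by move=> k; rewrite normrM -mulrA ler_wpM2l.
Qed.

Lemma egf_cvg a t : exp_bounded a -> cvgn (pseries (fun k => a k / k`!%:R) t).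
Proof.
move=> [C [r [C0 r0 h]]]; apply: normed_cvg.
have cv : cvgn (series (C *: exp_coeff (r * `|t|))).
  exact: is_cvg_seriesZ (is_cvg_series_exp_coeff _).
apply: (series_le_cvg _ _ _ cv) => k /=; first exact: normr_ge0.
  by rewrite /exp_coeff /= mulr_ge0 // divr_ge0 // exprn_ge0 // mulr_ge0.
have -> : (C *: exp_coeff (r * `|t|)) k = C * r ^+ k * (`|t| ^+ k / k`!%:R).
  by rewrite (_ : (C *: _) k = C * ((r * `|t|) ^+ k / k`!%:R)) // exprMn !mulrA.
rewrite !normrM normfV normrX [`|_`!%:R|]ger0_norm // mulrAC -[leLHS]mulrA.
by rewrite ler_wpM2r // divr_ge0 // exprn_ge0.
Qed.

Lemma pseries_diffs_egf a :
  pseries_diffs (fun k => a k / k`!%:R) = (fun k => a k.+1 / k`!%:R).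
Proof.
apply/funext => k; rewrite /pseries_diffs factS natrM invfM mulrCA.
by rewrite mulVKf // mulrC.
Qed.

Lemma egf_derive a t : exp_bounded a ->
  is_derive t (1 : R) (egf a) (egf (fun k => a k.+1) t).
Proof.
move=> ba; have ba1 := exp_bounded_shift ba; have ba2 := exp_bounded_shift ba1.
have := @pseries_snd_diffs R (fun k => a k / k`!%:R) (`|t| + 1) t.
rewrite !pseries_diffs_egf; apply; try exact: egf_cvg.
by rewrite [ltRHS]ger0_norm ?ltrDl // addr_ge0.
Qed.

Lemma egf_continuous a : exp_bounded a -> continuous (egf a).
Proof.
move=> ba t; apply/differentiable_continuous/derivable1_diffP.
exact: (@ex_derive _ _ _ _ _ _ _ (egf_derive t ba)).
Qed.

Lemma egf0 a : egf a 0 = a 0%N.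
Proof.
apply/cvg_lim => //; apply: cvg_near_cst; exists 1%N => // k /= k0.
rewrite /pseries /series /= -(prednK k0) big_nat_recl // expr0 mulr1 fact0 divr1.
by rewrite big1 ?addr0 // => i _; rewrite expr0n mulr0.
Qed.

Lemma egfD a b t : exp_bounded a -> exp_bounded b ->
  egf (fun k => a k + b k) t = egf a t + egf b t.
Proof.
move=> ha hb; rewrite /egf -limD; [|exact: egf_cvg..]; congr (lim (_ @ \oo)).
apply/funext => N; rewrite /pseries /series /= fctE -big_split /=.
by apply: eq_bigr => k _; ring.
Qed.

Lemma egfZ c a t : exp_bounded a ->
  egf (fun k => c * a k) t = c * egf a t.
Proof.
move=> ha; rewrite -[RHS](lim_seriesZ c (egf_cvg (t := t) ha)).
congr (lim (series _ @ \oo)); apply/funext => k /=.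
by rewrite (_ : (c *: _) k = c * (a k / k`!%:R * t ^+ k)) // !mulrA.
Qed.

Lemma egf_lincomb (I : Type) (r : seq I) (c : I -> R) (a : I -> nat -> R) t :
  (forall i, exp_bounded (a i)) ->
  exp_bounded (fun k => \sum_(i <- r) c i * a i k) /\
  egf (fun k => \sum_(i <- r) c i * a i k) t = \sum_(i <- r) c i * egf (a i) t.
Proof.
move=> ha; elim: r => [|i r [IHb IHe]].
  have -> : (fun k : nat => \sum_(i <- [::]) c i * a i k) = (fun=> 0).
    by apply/funext => k; rewrite big_nil.
  have b0 : exp_bounded (fun=> 0).
    by exists 0, 0; split => // k; rewrite normr0 mul0r.
  split => //; rewrite big_nil; have := egfZ 0 t b0.
  by rewrite !mul0r.
have -> : (fun k : nat => \sum_(j <- i :: r) c j * a j k) =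
    (fun k => c i * a i k + \sum_(j <- r) c j * a j k).
  by apply/funext => k; rewrite big_cons.
split; first by apply: exp_boundedD => //; exact: exp_boundedZ.
by rewrite egfD ?egfZ ?IHe ?big_cons //; exact: exp_boundedZ.
Qed.

Lemma egf_delta (c t : R) : egf (fun k => c *+ (k == 0%N)) t = c.
Proof.
apply/cvg_lim => //; apply: cvg_near_cst; exists 1%N => // k /= k0.
rewrite /pseries /series /= -(prednK k0) big_nat_recl // expr0 mulr1 fact0 divr1.
by rewrite eqxx mulr1n big1 ?addr0 // => i _; rewrite /= mulr0n !mul0r.
Qed.

(** All derivatives vanish on the open half-line, hence at [0] by continuity,
    where they are the coefficients. *)
Lemma egf_eq0 a : exp_bounded a -> (forall t, 0 <= t -> egf a t = 0) ->
  forall k, a k = 0.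
Proof.
move=> ba ha k; elim: k a ba ha => [|k IHk] a ba ha; first by rewrite -egf0 ha.
apply: (IHk (fun k => a k.+1)) => [|t t0]; first exact: exp_bounded_shift.
have pos (s : R) : 0 < s -> egf (fun k => a k.+1) s = 0.
  move=> s0; have [_ <-] := egf_derive s ba.
  rewrite (@near_eq_derive _ _ _ (egf a) (cst 0)) ?derive_cst //.
  near=> z; apply: ha; apply: ltW; near: z; exact: lt_nbhsr.
move: t0; rewrite le_eqVlt => /predU1P[<-|]; last exact: pos.
have c0 := @egf_continuous _ (exp_bounded_shift ba) 0.
have c1 : egf (fun k => a k.+1) s @[s --> 0^'+] --> egf (fun k => a k.+1) 0.
  exact: cvg_at_right_filter.
rewrite -(cvg_lim _ c1) //; apply/cvg_lim => //.
apply: cvg_near_cst; near=> z; apply: pos; near: z; exact: nbhs_right_gt.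
Unshelve. all: by end_near. Qed.

End egf.

(** * Affine equations with constant coefficients *)

Section flow.
Context (R : realType) (n : nat).
Implicit Types (F : 'M[R]_n) (b v : 'cV[R]_n) (t : R).

Lemma exp_bounded_mulX F v i : exp_bounded (fun k => (F ^+ k *m v) i 0).
Proof.
pose M := \sum_j `|v j 0|; pose q := \sum_i \sum_j `|F i j|.
have q0 : 0 <= q by apply: sumr_ge0 => *; exact: sumr_ge0.
have M0 : 0 <= M by exact: sumr_ge0.
exists M, q; split => // k; elim: k i => [|k IHk] i.
  rewrite expr0 mulr1 mul1mx /M (bigD1 i) //= lerDl; exact: sumr_ge0.
rewrite exprS -mulmxA mxE (le_trans (ler_norm_sum _ _ _)) //.
apply: (@le_trans _ _ (\sum_j `|F i j| * (M * q ^+ k))).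
  by apply: ler_sum => j _; rewrite normrM ler_wpM2l.
rewrite -mulr_suml exprS [leRHS]mulrCA ler_wpM2r //.
  by rewrite mulr_ge0 // exprn_ge0.
rewrite /q [leRHS](bigD1 i) //= lerDl; apply: sumr_ge0 => *; exact: sumr_ge0.
Qed.

(** The derivatives at [0] of the solution of [y' = F y + b], [y 0 = v]. *)
Definition flow_coef F b v (k : nat) : 'cV[R]_n :=
  if k is j.+1 then F ^+ j *m (F *m v + b) else v.

Lemma flow_coefS F b v k :
  flow_coef F b v k.+1 = F *m flow_coef F b v k + b *+ (k == 0%N).
Proof.
case: k => [|k] /=; first by rewrite expr0 mul1mx.
by rewrite mulr0n addr0 exprS mulmxA.
Qed.

Definition flow F b v t : 'cV[R]_n := \col_i egf (fun k => flow_coef F b v k i 0) t.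

Lemma flow_coef_exp_bounded F b v i : exp_bounded (fun k => flow_coef F b v k i 0).
Proof.
have [C [r [C0 r0 h]]] := exp_bounded_mulX F (F *m v + b) i.
exists (`|v i 0| + C), (r + 1); split; rewrite ?addr_ge0 // => -[|k] /=.
  by rewrite expr0 mulr1 lerDl.
apply: (le_trans (h k)); apply: ler_pM => //; first exact: exprn_ge0.
  by rewrite lerDr.
apply: (@le_trans _ _ ((r + 1) ^+ k)).
  by rewrite lerXn2r ?nnegrE ?addr_ge0 // lerDl.
by rewrite exprSr ler_peMr ?exprn_ge0 ?addr_ge0 // lerDr.
Qed.

Lemma flow0 F b v : flow F b v 0 = v.
Proof. by apply/colP => i; rewrite mxE egf0. Qed.

Lemma flow_derive F b v t i :
  is_derive t (1 : R) (fun s => flow F b v s i 0) ((F *m flow F b v t + b) i 0).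
Proof.
have hb j := flow_coef_exp_bounded F b v j.
rewrite (_ : (fun s => _) = egf (fun k => flow_coef F b v k i 0)); last first.
  by apply/funext => s; rewrite mxE.
apply: is_derive_eq; first exact: egf_derive.
rewrite (_ : (fun k => _) = (fun k => (\sum_j F i j * flow_coef F b v k j 0) +
    b i 0 *+ (k == 0%N))); last first.
  apply/funext => k; rewrite flow_coefS mxE mxE; congr (_ + _).
  by case: (k == 0%N); rewrite ?mulr1n // mulr0n mxE.
have [hs he] := egf_lincomb (index_enum _) (fun j => F i j) t hb.
rewrite egfD ?egf_delta ?he //; last first.
  exists `|b i 0|, 1; split => // k; rewrite expr1n mulr1.
  by case: (k == 0%N); rewrite ?mulr1n ?mulr0n ?normr0.
rewrite mxE mxE; congr (_ + _); apply: eq_bigr => j _; by rewrite mxE.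
Qed.

Lemma flow_continuous F b v : continuous (flow F b v).
Proof.
apply: continuous_mx_entries => i j t; rewrite ord1.
apply/differentiable_continuous/derivable1_diffP.
exact: (@ex_derive _ _ _ _ _ _ _ (flow_derive F b v t i)).
Qed.

Lemma flow_field_continuous F b v i :
  continuous (fun r : R => (F *m flow F b v r + b) i 0).
Proof.
rewrite (_ : (fun _ => _) = (fun r => (F *m flow F b v r) i 0 + b i 0)); last first.
  by apply/funext => r; rewrite mxE.
have cF : continuous (fun r : R => (F *m flow F b v r) i 0).
  apply: (@coord_comp_continuous R R n 1 (fun r => F *m flow F b v r)).
  by apply: continuous_mulmx; [exact: cst_continuous|exact: flow_continuous].
by move=> r; apply: cvgD; [exact: cF|exact: cvg_cst].
Qed.

Lemma flow_integral F b v (a t : R) i : a <= t ->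
  \int[leb R]_(r in `[a, t]) (F *m flow F b v (r - a) + b) i 0 =
  flow F b v (t - a) i 0 - v i 0.
Proof.
move=> at_; pose G (r : R) : R := (F *m flow F b v (r - a) + b) i 0.
have dG (x : R) : is_derive x (1 : R) (fun r : R => flow F b v (r - a) i 0) (G x).
  have ds : is_derive x (1 : R) (fun r : R => r - a) (1 - 0).
    exact: is_deriveB.
  apply: is_derive_eq.
    exact: (@is_derive1_comp R (fun s => flow F b v s i 0) (fun r => r - a) x _ _
      (flow_derive F b v (x - a) i) ds).
  by rewrite subr0 mulr1.
have cG : continuous G.
  move=> z; apply: (@continuous_comp _ _ _ (fun r : R => r - a)
    (fun r => (F *m flow F b v r + b) i 0)); last exact: flow_field_continuous.
  by apply: cvgB; [exact: cvg_id|exact: cvg_cst].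
by rewrite (leb_FTC at_ dG cG) subrr flow0.
Qed.

End flow.

(** * Responses to pulses *)

Section pulses.
Context (R : realType) (n : nat).
Implicit Types (s : bilinear_sys R n).

Lemma pulses_inputs (alpha : R) : pulses alpha `<=` @inputs R.
Proof.
move=> u [tau /andP[tau0 tauT] hu]; split; first by rewrite (le_trans tau0) // ltW.
  rewrite hu (_ : pulse tau alpha = (fun t => alpha * \1_(`[0, tau[%classic : set R) t)).
    apply: measurable_funM; first exact: measurable_cst.
    exact/measurable_indic/measurable_itv_leb.
  apply/funext => t; rewrite /pulse indicE mem_setE in_itv /=.
  by case: ifP; rewrite ?mulr1 ?mulr0.
exists `|alpha|; apply: (@filterS _ _ (leb_ae_filter R) setT); last first.
  exact: (@filterT _ _ (leb_ae_filter R)).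
by move=> t _ _; rewrite hu /pulse; case: ifP; rewrite ?normr0.
Qed.

Lemma Rintegral_leb_bndo (f : R -> R) (a : R) : 0 <= a ->
  (leb R).-integrable `[0, a] (EFin \o f) ->
  \int[leb R]_(r in `[0, a]) f r = \int[leb R]_(r in `[0, a[) f r.
Proof.
move=> a0 fi.
have e : `[0, a]%classic = `[0, a[%classic `|` [set a] :> set R.
  by rewrite setUitv1.
have m1 : measurable ([set a] : set (lebesgue_line R)) by exact: measurable_leb.
rewrite e Rintegral_setU //.
- rewrite [X in _ + X](_ : _ = 0) ?addr0 //.
  rewrite /Rintegral null_set_integral //.
  + exact: measurable_fun_set1.
  + by change (lebesgue_measure ([set a] : set R) = 0%E); rewrite lebesgue_measure_set1.
- exact: measurable_itv_leb.
- by rewrite -e.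
- apply/disj_setPS => x /= [] /[swap] ->.
  by rewrite in_itv /= ltxx andbF.
Qed.

(** The state at time [tau] under the constant input [alpha]. *)
Definition driven s alpha tau :=
  flow (sysA s + alpha *: sysN s) (alpha *: sysb s) 0 tau.

(** The state at time [t >= tau] when the input drops to [0] at time [tau]. *)
Definition released s alpha tau t :=
  flow (sysA s) 0 (driven s alpha tau) (t - tau).

(** [driven] up to time [tau] and [released] from then on, written without a
    case distinction so that continuity is inherited from that of [flow]. *)
Definition pulse_state s (alpha tau t : R) : 'cV[R]_n :=
  driven s alpha (Num.min t tau) +
  (released s alpha tau (Num.max t tau) - driven s alpha tau).

Lemma pulse_state_le s (alpha tau t : R) : t <= tau ->
  pulse_state s alpha tau t = driven s alpha t.
Proof.
move=> tt; rewrite /pulse_state (min_idPl tt) (max_idPr tt).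
by rewrite /released subrr flow0 subrr addr0.
Qed.

Lemma pulse_state_ge s (alpha tau t : R) : tau <= t ->
  pulse_state s alpha tau t = released s alpha tau t.
Proof.
move=> tt; rewrite /pulse_state (min_idPr tt) (max_idPl tt).
by rewrite addrC subrK.
Qed.

Lemma pulse_state_continuous s (alpha tau : R) : continuous (pulse_state s alpha tau).
Proof.
have cmin : continuous (fun t : R => Num.min t tau).
  by move=> t; apply: (@continuous_min R R id (cst tau)) => //; exact: cvg_cst.
have cmax : continuous (fun t : R => Num.max t tau).
  by move=> t; apply: (@continuous_max R R id (cst tau)) => //; exact: cvg_cst.
have c1 : continuous (fun t : R => driven s alpha (Num.min t tau)).
  move=> t; apply: (@continuous_comp _ _ _ (fun t : R => Num.min t tau) (driven s alpha)).
    exact: cmin.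
  exact: flow_continuous.
have c2 : continuous (fun t : R => released s alpha tau (Num.max t tau)).
  move=> t; apply: (@continuous_comp _ _ _ (fun t : R => Num.max t tau - tau)
    (flow (sysA s) 0 (driven s alpha tau))).
    by apply: cvgB; [exact: cmax|exact: cvg_cst].
  exact: flow_continuous.
apply: continuous_mx_entries => i j t.
rewrite (_ : (fun t => _) = (fun t => driven s alpha (Num.min t tau) i j +
  (released s alpha tau (Num.max t tau) i j - driven s alpha tau i j))); last first.
  by apply/funext => z; rewrite !mxE.
have d1 := @coord_comp_continuous R R n 1 _ i j c1.
have d2 := @coord_comp_continuous R R n 1 _ i j c2.
by apply: cvgD; [exact: d1|apply: cvgB; [exact: d2|exact: cvg_cst]].
Qed.

(** Before and after time [tau] the state equation is the one that defines
    [driven], respectively [released]. *)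
Lemma is_state_pulse s (alpha tau : R) (u : signal R) :
  0 <= tau < u.1 -> u.2 = pulse tau alpha ->
  is_state s u (pulse_state s alpha tau).
Proof.
move=> tauT hu; have /andP[tau0 _] := tauT.
have uin : inputs u by apply: (@pulses_inputs alpha); exists tau.
have cx : {within `[0, u.1], continuous (pulse_state s alpha tau)}.
  by apply: continuous_subspaceT; exact: pulse_state_continuous.
split=> // t tT i.
have /andP[t0 tT1] : 0 <= t <= u.1 by move: tT; rewrite in_itv.
pose V r := vfield s u (pulse_state s alpha tau) r i 0.
change (pulse_state s alpha tau t i 0 = \int[leb R]_(r in `[0, t]) V r).
have VE r : 0 <= r < tau -> V r =
    ((sysA s + alpha *: sysN s) *m driven s alpha r + alpha *: sysb s) i 0.
  move=> r0; rewrite /V /vfield hu /pulse r0 pulse_state_le //.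
  by have /andP[_ /ltW] := r0.
have VE2 r : tau <= r -> V r = (sysA s *m released s alpha tau r + 0) i 0.
  move=> rt; rewrite /V /vfield hu /pulse [r < tau]ltNge rt andbF.
  by rewrite !scale0r !addr0 pulse_state_ge.
have int1 a : 0 <= a ->
    \int[leb R]_(r in `[0, a]) ((sysA s + alpha *: sysN s) *m driven s alpha r
      + alpha *: sysb s) i 0 = driven s alpha a i 0.
  move=> a0; have := flow_integral (sysA s + alpha *: sysN s) (alpha *: sysb s) 0 i a0.
  rewrite subr0 [X in _ - X]mxE subr0 => <-.
  by apply: eq_Rintegral => r _; rewrite subr0.
have iV a : a \in `[0, u.1] -> (leb R).-integrable `[0, a] (EFin \o V).
  by move=> aT; exact: vfield_integrable.
have [ttau|taut] := ltP t tau.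
  rewrite pulse_state_le ?ltW // -int1 //; apply: eq_Rintegral => r.
  rewrite inE /= in_itv /= => /andP[r0 rt].
  by rewrite VE // r0 (le_lt_trans rt).
rewrite pulse_state_ge //.
have e : `[0, t]%classic = `[0, tau[%classic `|` `[tau, t]%classic :> set R.
  by rewrite -itv_bndbnd_setU ?bnd_simp.
have tauI : tau \in `[0, u.1] by rewrite in_itv /= tau0 (le_trans taut).
rewrite e Rintegral_setU //; first last.
- apply/disj_setPS => x /= [].
  by rewrite !in_itv /= => /andP[_ xt] /andP[tx _]; rewrite ltNge tx in xt.
- by rewrite -e; exact: iV.
- exact: measurable_itv_leb.
- exact: measurable_itv_leb.
rewrite [X in _ + X](_ : _ = released s alpha tau t i 0 - driven s alpha tau i 0); last first.
  rewrite -flow_integral //; apply: eq_Rintegral => r.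
  by rewrite inE /= in_itv /= => /andP[tr _]; rewrite VE2.
rewrite [X in X + _](_ : _ = driven s alpha tau i 0); first by rewrite addrC subrK.
(* at [tau] the input is already [0], so the endpoint has to be dropped *)
rewrite -int1 // [RHS]Rintegral_leb_bndo //.
  apply: eq_Rintegral => r; rewrite inE /= in_itv /= => rt; exact: VE.
apply: continuous_leb_integrable => //; exact: flow_field_continuous.
Qed.
End pulses.

(** * Moments and realizations *)

Section moments.
Context (R : realType) (n : nat).
Implicit Types (s : bilinear_sys R n).

Lemma egf_inj (a b : nat -> R) : exp_bounded a -> exp_bounded b ->
  (forall t, 0 <= t -> egf a t = egf b t) -> forall k, a k = b k.
Proof.
move=> ba bb hab k; apply/eqP; rewrite -subr_eq0 -mulN1r; apply/eqP.
have bb' := exp_boundedZ (-1) bb.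
apply: (@egf_eq0 R (fun k => a k + -1 * b k)) => [|t t0].
  exact: exp_boundedD.
by rewrite egfD // egfZ // hab // mulN1r subrr.
Qed.

Lemma egf_functional (d : 'rV[R]_n) F b v t :
  exp_bounded (fun k => (d *m flow_coef F b v k) 0 0) /\
  egf (fun k => (d *m flow_coef F b v k) 0 0) t = (d *m flow F b v t) 0 0.
Proof.
have [hb he] := egf_lincomb (index_enum _) (fun j => d 0 j) t
  (flow_coef_exp_bounded F b v).
rewrite (_ : (fun k => _) = (fun k => \sum_j d 0 j * flow_coef F b v k j 0)); last first.
  by apply/funext => k; rewrite mxE.
by split => //; rewrite he mxE; apply: eq_bigr => j _; rewrite mxE.
Qed.

Lemma functional_flow_inj (d1 d2 : 'rV[R]_n) F1 F2 b1 b2 v1 v2 :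
  (forall t : R, 0 <= t -> (d1 *m flow F1 b1 v1 t) 0 0 = (d2 *m flow F2 b2 v2 t) 0 0) ->
  forall k, (d1 *m flow_coef F1 b1 v1 k) 0 0 = (d2 *m flow_coef F2 b2 v2 k) 0 0.
Proof.
move=> h.
apply: (@egf_inj (fun k => (d1 *m flow_coef F1 b1 v1 k) 0 0)
  (fun k => (d2 *m flow_coef F2 b2 v2 k) 0 0)).
- by have [] := egf_functional d1 F1 b1 v1 0.
- by have [] := egf_functional d2 F2 b2 v2 0.
move=> t t0; have [_ ->] := egf_functional d1 F1 b1 v1 t.
by have [_ ->] := egf_functional d2 F2 b2 v2 t; exact: h.
Qed.

Lemma output_pulse s (alpha tau r : R) : 0 <= tau -> 0 <= r ->
  output s (tau + r + 1, pulse tau alpha) (tau + r) =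
  (sysc s *m flow (sysA s) 0 (driven s alpha tau) r) 0 0.
Proof.
move=> tau0 r0; have tauT : 0 <= tau < tau + r + 1.
  by rewrite tau0 -addrA ltrDl ltr_wpDl.
have uin : inputs (tau + r + 1, pulse tau alpha).
  by apply: (@pulses_inputs R alpha); exists tau.
have st := @is_state_pulse R n s alpha tau (tau + r + 1, pulse tau alpha) tauT erefl.
rewrite /output (state_eq uin st).
  by rewrite pulse_state_ge ?lerDl // /released addrAC subrr add0r.
by rewrite in_itv /= addr_ge0 // lerDl ler01.
Qed.

(** The output after the pulse is an exponential generating function in the
    time [r] elapsed since its end, with coefficients [c A^i x(tau)]; each of
    these is in turn one in [tau], with coefficients [alpha c A^i F^j b]. *)
Lemma pulse_equiv_moments (alpha : R) s1 s2 : alpha <> 0 ->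
  io_equiv_wrt (pulses alpha) s1 s2 ->
  forall i j,
    (sysc s1 *m sysA s1 ^+ i *m ((sysA s1 + alpha *: sysN s1) ^+ j *m sysb s1)) 0 0 =
    (sysc s2 *m sysA s2 ^+ i *m ((sysA s2 + alpha *: sysN s2) ^+ j *m sysb s2)) 0 0.
Proof.
move=> alpha0 heq i j.
have coefE s v k : flow_coef (sysA s) 0 v k = sysA s ^+ k *m v.
  by case: k => [|k] /=; rewrite ?expr0 ?mul1mx // addr0 exprSr mulmxA.
have h1 (tau : R) : 0 <= tau ->
    (sysc s1 *m sysA s1 ^+ i *m driven s1 alpha tau) 0 0 =
    (sysc s2 *m sysA s2 ^+ i *m driven s2 alpha tau) 0 0.
  move=> tau0; rewrite -!mulmxA -!coefE; move: i; apply: functional_flow_inj => r r0.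
  have uin : pulses alpha (tau + r + 1, pulse tau alpha).
    by exists tau => //=; rewrite tau0 -addrA ltrDl ltr_wpDl.
  have tin : tau + r \in `[0, (tau + r + 1, pulse tau alpha).1].
    by rewrite in_itv /= addr_ge0 // lerDl ler01.
  apply: etrans (esym (output_pulse s1 alpha tau0 r0)) _.
  exact: etrans (heq _ uin _ tin) (output_pulse s2 alpha tau0 r0).
have := functional_flow_inj h1 j.+1 => /=.
rewrite !mulmx0 !add0r -!scalemxAr [LHS]mxE [RHS]mxE.
by apply: mulfI; apply/eqP.
Qed.

End moments.

Section realization.
Context (K : comUnitRingType) (n : nat).

(** The observability matrix of [(A, c)]. *)
Definition obsv (A : 'M[K]_n) (c : 'rV[K]_n) : 'M[K]_n :=
  \matrix_(i, j) (c *m A ^+ i) 0 j.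

(** The controllability matrix of [(F, b)]. *)
Definition ctrb (F : 'M[K]_n) (b : 'cV[K]_n) : 'M[K]_n :=
  \matrix_(i, j) (F ^+ j *m b) i 0.

Lemma obsv_mul_ctrb A c M F b i j :
  (obsv A c *m M *m ctrb F b) i j = (c *m A ^+ i *m M *m (F ^+ j *m b)) 0 0.
Proof.
rewrite mxE [RHS]mxE; apply: eq_bigr => k _; rewrite [ctrb _ _ _ _]mxE.
congr (_ * _); rewrite mxE [RHS]mxE; apply: eq_bigr => l _; by rewrite mxE.
Qed.

(** Cancelling the invertible factors in [O1 *m K1 = O2 *m K2] gives one
    matrix [T] with [O1 = O2 *m T] and [K2 = T *m K1].  Applied to the shifted
    products, the same cancellation gives the intertwining relations; [b] and
    [c] are read off the first column of [K] and the first row of [O]. *)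
Lemma realization_unique (A1 A2 F1 F2 : 'M[K]_n) (b1 b2 : 'cV[K]_n) (c1 c2 : 'rV[K]_n) :
  (0 < n)%N ->
  obsv A1 c1 \in unitmx -> obsv A2 c2 \in unitmx ->
  ctrb F1 b1 \in unitmx -> ctrb F2 b2 \in unitmx ->
  (forall i j, (c1 *m A1 ^+ i *m (F1 ^+ j *m b1)) 0 0 =
               (c2 *m A2 ^+ i *m (F2 ^+ j *m b2)) 0 0) ->
  exists2 T : 'M[K]_n, T \in unitmx &
    [/\ T *m A1 = A2 *m T, T *m F1 = F2 *m T, b2 = T *m b1 & c1 = c2 *m T].
Proof.
move=> n0 uO1 uO2 uK1 uK2 hm.
pose O1 := obsv A1 c1; pose O2 := obsv A2 c2.
pose K1 := ctrb F1 b1; pose K2 := ctrb F2 b2.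
have hOK : O1 *m K1 = O2 *m K2.
  apply/matrixP => i j.
  by rewrite -(mulmx1 O1) -(mulmx1 O2) !obsv_mul_ctrb !mulmx1.
have hOA : O1 *m A1 *m K1 = O2 *m A2 *m K2.
  apply/matrixP => i j; rewrite !obsv_mul_ctrb.
  by have := hm i.+1 j; rewrite !exprSr !mulmxA.
have hOF : O1 *m F1 *m K1 = O2 *m F2 *m K2.
  apply/matrixP => i j; rewrite !obsv_mul_ctrb.
  by have := hm i j.+1; rewrite !exprS !mulmxA.
pose T := invmx O2 *m O1.
have hO : O1 = O2 *m T by rewrite /T mulKVmx.
have hK : K2 = T *m K1 by rewrite /T -mulmxA hOK mulKmx.
have conj (M1 M2 : 'M[K]_n) : O1 *m M1 *m K1 = O2 *m M2 *m K2 -> T *m M1 = M2 *m T.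
  rewrite hK hO -!mulmxA => /(can_inj (mulKmx uO2)).
  by rewrite !mulmxA => /(can_inj (mulmxK uK1)).
exists T; first by rewrite unitmx_mul unitmx_inv uO2.
pose i0 := Ordinal n0.
split; [exact: conj|exact: conj| |].
- have bE (F : 'M[K]_n) b : b = ctrb F b *m delta_mx i0 0.
    by apply/colP => i; rewrite -colE [RHS]mxE [RHS]mxE expr0 mul1mx.
  by rewrite [LHS](bE F2) [in RHS](bE F1 b1) mulmxA -hK.
- have cE (A : 'M[K]_n) c : c = delta_mx 0 i0 *m obsv A c.
    by apply/rowP => i; rewrite -rowE [RHS]mxE [RHS]mxE expr0 mulmx1.
  by rewrite [LHS](cE A1) [in RHS](cE A2 c2) -mulmxA -hO.
Qed.
End realization.

(** The [N]'s are intertwined because [A] and [A + alpha N] are and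
    [alpha] is invertible. *)
Lemma pulse_equiv_io_equiv (R : realType) (n : nat) (alpha : R) (s1 s2 : bilinear_sys R n) :
  (0 < n)%N -> alpha <> 0 ->
  obsv (sysA s1) (sysc s1) \in unitmx -> obsv (sysA s2) (sysc s2) \in unitmx ->
  ctrb (sysA s1 + alpha *: sysN s1) (sysb s1) \in unitmx ->
  ctrb (sysA s2 + alpha *: sysN s2) (sysb s2) \in unitmx ->
  io_equiv_wrt (pulses alpha) s1 s2 -> io_equiv s1 s2.
Proof.
move=> n0 alpha0 uO1 uO2 uK1 uK2 h.
have [T uT [hA hF hb hc]] := realization_unique n0 uO1 uO2 uK1 uK2
  (pulse_equiv_moments alpha0 h).
apply: (similar_io_equiv uT); split => //.
move: hF; rewrite mulmxDr mulmxDl hA => /addrI; rewrite -scalemxAr -scalemxAl.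
by move/(scalerI (introN eqP alpha0)).
Qed.

(** * Countable unions of null sets *)

Section null_sets.
Context (R : realType) (l : nat).
Implicit Types (X : set 'rV[R]_l) (a b : nat -> 'rV[R]_l).

Lemma box_volume_ge0 (a b : 'rV[R]_l) :
  (forall i, a 0 i <= b 0 i) -> 0 <= box_volume a b.
Proof. by move=> ab; apply: prodr_ge0 => i _; rewrite subr_ge0. Qed.

(** Covers of the [X k] of total volume [e / 2 ^ k.+1] are merged into a single
    cover along a bijection between [nat] and [nat * nat]. *)
Lemma lebesgue_outer_bigcup0 (X : nat -> set 'rV[R]_l) :
  (forall k (e : R), 0 < e -> exists a b, box_cover (X k) a b /\
     (\sum_(0 <= j <oo) (box_volume (a j) (b j))%:E <= e%:E)%E) ->
  lebesgue_outer (\bigcup_k X k) = 0%E.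
Proof.
move=> hX; apply/eqP; rewrite eq_le; apply/andP; split; last first.
  apply: le_ereal_inf_tmp => _ [a [b [[ab _] ->]]].
  by apply: nneseries_ge0 => k _ _; rewrite lee_fin box_volume_ge0.
apply/lee_addgt0Pr => e e0; rewrite add0e.
have hk k : exists ab : (nat -> 'rV[R]_l) * (nat -> 'rV[R]_l),
    box_cover (X k) ab.1 ab.2 /\
    (\sum_(0 <= j <oo) (box_volume (ab.1 j) (ab.2 j))%:E <=
       (e / (2 ^ k.+1)%:R)%:E)%E.
  have [|a [b h]] := hX k (e / (2 ^ k.+1)%:R).
    by rewrite divr_gt0 // ltr0n expn_gt0.
  by exists (a, b).
have {hk}[G hG] := boolp.choice hk.
pose vol (p : nat * nat) : \bar R := (box_volume ((G p.1).1 p.2) ((G p.1).2 p.2))%:E.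
have vol0 p : (0 <= vol p)%E.
  by rewrite lee_fin box_volume_ge0 //; have [[h _] _] := hG p.1; exact: h.
have /card_esym/ppcard_eqP[f] := card_nat2.
apply: (@le_trans _ _ (\sum_(0 <= m <oo) vol (f m))%E).
  apply: ereal_inf_lbound => /=.
  exists (fun m => (G (f m).1).1 (f m).2), (fun m => (G (f m).1).2 (f m).2).
  split => //; split => [m i|x [k _ Xx]].
    by have [[h _] _] := hG (f m).1; exact: h.
  have [[_ h] _] := hG k; have [j _ xj] := h x Xx.
  by exists (f^-1%FUN (k, j)) => //=; rewrite invK ?inE.
rewrite nneseries_esumT; last by move=> m; exact: vol0.
rewrite -(reindex_esum setT setT f vol); last exact: bij.
rewrite (_ : setT = setT `*`` (fun=> setT)); last first.
  by apply/seteqP; split.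
rewrite -(@esum_esum _ _ _ setT (fun=> setT) (fun i j => vol (i, j))) //.
rewrite (eq_esum (b := fun i => \sum_(0 <= j <oo) vol (i, j)))%E; last first.
  by move=> i _; rewrite nneseries_esumT.
rewrite -nneseries_esumT; last by move=> i; exact: nneseries_ge0.
apply: (le_trans _ (epsilon_trick0 xpredT (ltW e0))).
apply: lee_nneseries => [i _ _|i _ ]; first exact: nneseries_ge0.
by have [_] := hG i.
Qed.
End null_sets.

(** * Sets meeting parallel lines in few points are null *)

Section grid.
Context (R : realType) (l : nat) (Z : set 'rV[R]_l) (vb : 'I_l -> bool) (d : nat).
Let v : 'rV[R]_l := \row_i (vb i)%:R.
Hypothesis Zclosed : closed Z.
Hypothesis Zline : forall x, exists P : {poly R},
  [/\ P != 0, (size P <= d.+1)%N & forall s, Z (x + s *: v) -> root P s].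

(** The translates of [Z] by [j / M] times [v] through [x] give distinct roots
    of one polynomial. *)
Lemma few_translates (M : nat) (x : 'rV[R]_l) :
  (#|[pred j : 'I_M | `[< Z (x - (j%:R / M%:R) *: v)%R >]]| <= d)%N.
Proof.
have [P [P0 szP hP]] := Zline x.
pose s := [seq - (nat_of_ord j)%:R / M%:R : R | j <- enum [pred j : 'I_M | `[< Z (x - (j%:R / M%:R) *: v)%R >]]].
have us : uniq s.
  rewrite map_inj_in_uniq ?enum_uniq // => j1 j2 _ _.
  have M0 : (M%:R : R) != 0 by rewrite pnatr_eq0 -lt0n (leq_ltn_trans _ (ltn_ord j1)).
  move=> /(mulIf (invr_neq0 M0)) /oppr_inj /eqP; rewrite eqr_nat => /eqP.
  exact: val_inj.
have rs : all (root P) s.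
  apply/allP => _ /mapP[j + ->]; rewrite mem_enum inE => /asboolP Zj.
  by apply: hP; rewrite mulNr scaleNr; exact/asboolP.
by have := leq_trans (max_poly_roots P0 rs us) szP; rewrite size_map -cardE ltnS.
Qed.

(** The tolerance is the mesh of a grid.  It divides the step [1 / M], so that
    translations by multiples of that step along [v] map cells to cells. *)
Definition near_translate (M q : nat) (x : 'rV[R]_l) (j : nat) :=
  exists2 z, Z z & forall i, `|x 0 i - j%:R / M%:R * v 0 i - z 0 i| <= (M * q.+1)%:R^-1.

(** On a compact set the bound on the number of translates survives a small
    enlargement: each [x] has a neighbourhood that stays away from the finitely
    many closed translates missing [x]. *)
Lemma near_few_translates (M : nat) (K : set 'rV[R]_l) : (0 < M)%N -> compact K ->
  \forall q \near \oo, forall x, K x ->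
    (#|[pred j : 'I_M | `[< near_translate M q x j >]]| <= d)%N.
Proof.
move=> M0 /compact_near_coveringP cK; apply: cK => x Kx.
have far (j : 'I_M) : \forall x' \near x & q \near \oo,
    ~ Z (x - (j%:R / M%:R) *: v) -> ~ near_translate M q x' j.
  have [Zj|nZj] := pselect (Z (x - (j%:R / M%:R) *: v)).
    by near=> x' q => /(_ Zj).
  have : nbhs (x - (j%:R / M%:R) *: v) (~` Z).
    by apply: open_nbhs_nbhs; split => //; exact: closed_openC.
  move=> /nbhs_ballP[_/posnumP[e] he].
  near=> x' q => _ [z Zz hz]; apply: (he z) => //; split => // i i'.
  rewrite ord1 !mxE /ball /=.
  have h1 : `|x 0 i' - x' 0 i'| < e%:num / 2.
    have : ball x (e%:num / 2) x' by near: x'; apply: nbhsx_ballx; exact: divr_gt0.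
    by move=> [_ /(_ 0 i')].
  have h2 : (M * q.+1)%:R^-1 < e%:num / 2.
    apply: (@le_lt_trans _ _ q.+1%:R^-1); last first.
      by near: q; exact: (near_infty_natSinv_lt (e%:num / 2)%:pos).
    by rewrite lef_pV2 ?posrE ?ltr0n ?muln_gt0 ?M0 // ler_nat leq_pmull.
  rewrite (_ : _ - z 0 i' = (x 0 i' - x' 0 i') + (x' 0 i' - j%:R / M%:R * v 0 i' - z 0 i')); last first.
    by rewrite !mxE; ring.
  rewrite (le_lt_trans (ler_normD _ _)) // [ltRHS](splitr e%:num) ltrD //.
  exact: le_lt_trans (hz i') h2.
pose W (j : 'I_M) (p : 'rV[R]_l * nat) :=
  ~ Z (x - (j%:R / M%:R) *: v) -> ~ near_translate M p.2 p.1 j.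
have FF : Filter (filter_prod (nbhs x) \oo).
  exact: (filter_prod_filter (nbhs_filter x) eventually_filter).
have hall := @filter_forall _ _ W (filter_prod (nbhs x) \oo) FF far.
apply: (@filterS _ (filter_prod (nbhs x) \oo) FF _ _ _ hall) => -[x' q] /= h.
apply: leq_trans (@few_translates M x).
apply: subset_leq_card; apply/fintype.subsetP => j; rewrite !inE => hj.
by apply: contrapT => nZ; exact: (h j nZ hj).
Unshelve. all: by end_near. Qed.

Definition cube (B : R) : set 'rV[R]_l := [set x | forall i, - B <= x 0 i <= B].

Lemma cube_compact (B : R) : compact (cube B).
Proof.
rewrite (_ : cube B = [set x : 'rV[R]_l | forall i, `[- B, B]%classic (x ord0 i)]).
  apply: (@rV_compact R l (fun=> `[- B, B]%classic)) => i.
  exact: segment_compact.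
apply/seteqP; split => x /= h i; have := h i; rewrite in_itv /=; exact.
Qed.

(** [S] is the set of grid cells of side [h] that meet the part of [Z] in the
    cube.  Its [M] translates by [j / M] times [v] consist of as many grid
    cells each and, by [near_few_translates], cover no cell more than [d] times;
    hence [M * #|S|] is at most [d] times the number of all cells. *)
Lemma grid_count (B M : nat) : (0 < M)%N ->
  exists (G : nat) (h : R) (S : {set {ffun 'I_l -> 'I_G.+1}}),
    let corner (y : {ffun 'I_l -> 'I_G.+1}) : 'rV[R]_l := \row_i (- B%:R + (y i)%:R * h) in
    [/\ 0 < h,
      Z `&` cube B%:R `<=`
        \bigcup_(y in [set` S]) box (corner y) (corner y + const_mx h) &
      M%:R * (#|S|%:R * h ^+ l) <= d%:R * (2 * B + 2)%:R ^+ l].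
Proof.
move=> M0.
have [q0 _ hq0] := near_few_translates M0 (@cube_compact (B + 1)%:R).
pose q := q0.+1.
have {hq0}hq x : cube (B + 1)%:R x ->
    (#|[pred j : 'I_M | `[< near_translate M q0 x j >]]| <= d)%N.
  by move=> cx; exact: (hq0 q0 (leqnn _)).
pose Mq := (M * q)%N.
have Mq0 : (0 < Mq)%N by rewrite muln_gt0 M0.
have MqR : (0 : R) < Mq%:R by rewrite ltr0n.
pose h : R := Mq%:R^-1.
have h0 : 0 < h by rewrite invr_gt0.
(* one more unit than the cube needs, to make room for the translates *)
pose G := ((2 * B + 1) * Mq)%N.
pose corner (y : {ffun 'I_l -> 'I_G.+1}) : 'rV[R]_l := \row_i (- B%:R + (y i)%:R * h).
pose S : {set {ffun 'I_l -> 'I_G.+1}} := finset (fun y =>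
  `[< (Z `&` cube B%:R `&` box (corner y) (corner y + const_mx h)) !=set0 >]).
exists G, h, S; split => //.
  move=> z [Zz cz].
  pose t i := (z 0 i + B%:R) * Mq%:R.
  have t0 i : 0 <= t i.
    by have /andP[z1 _] := cz i; rewrite mulr_ge0 ?(ltW MqR) // -lerBlDr sub0r.
  have tle i : t i <= (2 * B * Mq)%:R.
    have /andP[_ z2] := cz i.
    by rewrite natrM ler_wpM2r ?(ltW MqR) // natrM mulr2n mulrDl mul1r lerD2r.
  have tr i : (Num.truncn (t i))%:R <= t i < (Num.truncn (t i)).+1%:R.
    exact: truncn_itv.
  have bnd i : (Num.truncn (t i) < G.+1)%N.
    have /andP[t1 _] := tr i; rewrite ltnS -(ler_nat R).
    rewrite (le_trans t1) // (le_trans (tle i)) // ler_nat leq_mul2r.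
    by rewrite leq_addr orbT.
  have tz i : z 0 i = - B%:R + t i * h by rewrite /t mulfK ?gt_eqF // addrCA addNr addr0.
  pose y : {ffun 'I_l -> 'I_G.+1} := [ffun i => Ordinal (bnd i)].
  have bz : box (corner y) (corner y + const_mx h) z.
    move=> i; rewrite !mxE ffunE /= tz lerD2l -addrA lerD2l -[X in _ + X]mul1r -mulrDl.
    have /andP[t1 t2] := tr i.
    by rewrite !(ler_pM2r h0) t1 natr1 ltW.
  exists y => //=; rewrite inE; apply/asboolP; by exists z.
pose shift (j : 'I_M) (y : {ffun 'I_l -> 'I_G.+1}) : {ffun 'I_l -> 'I_G.+1} :=
  [ffun i => inord (y i + j * q * vb i)].
have Sle y i : y \in S -> (y i <= 2 * B * Mq)%N.
  rewrite inE => /asboolP[z [[_ cz] bz]].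
  have /andP[_ z2] := cz i; have /andP[y1 _] := bz i.
  move: (le_trans y1 z2); rewrite mxE -lerBrDl opprK -ler_pdivlMr ?invr_gt0 //.
  by rewrite invrK -natrD -natrM ler_nat mul2n addnn.
have shiftE j y i : y \in S -> shift j y i = (y i + j * q * vb i)%N :> nat.
  move=> yS; rewrite ffunE inordK // ltnS.
  apply: (@leq_trans (2 * B * Mq + Mq)%N); last by rewrite /G mulnDl mul1n.
  apply: leq_add; first exact: Sle.
  by rewrite -[Mq]muln1 leq_mul ?leq_b1 // leq_mul2r (ltnW (ltn_ord j)) orbT.
have shift_inj j : {in S &, injective (shift j)}.
  move=> y1 y2 S1 S2 e; apply/ffunP => i; apply: val_inj => /=.
  by apply/eqP; rewrite -(eqn_add2r (j * q * vb i)) -!shiftE // e.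
have fiber y : (#|[pred j : 'I_M | y \in shift j @: S]| <= d)%N.
  have [j0' hj0|nj] := pickP [pred j : 'I_M | y \in shift j @: S]; last first.
    by rewrite eq_card0.
  have hs j y0 : y0 \in S -> forall i,
      corner (shift j y0) 0 i = corner y0 0 i + j%:R / M%:R * v 0 i.
    move=> Sy i; rewrite !mxE shiftE // natrD mulrDl addrA; congr (_ + _).
    rewrite /h /Mq !natrM invfM; field.
    by rewrite !pnatr_eq0 -lt0n M0.
  apply: leq_trans (hq (corner y) _).
    apply: subset_leq_card; apply/fintype.subsetP => j; rewrite !inE.
    move=> /imsetP[y0 Sy0 ->]; move: (Sy0); rewrite inE => /asboolP[z [[Zz cz] bz]].
    exists z => // i; rewrite hs // addrK.
    have /andP[z1 z2] := bz i; rewrite distrC ger0_norm ?subr_ge0 //.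
    by rewrite lerBlDl; move: z2; rewrite [in X in X -> _]mxE [const_mx h _ _]mxE.
  move: hj0 => /= /imsetP[y0 Sy0 ->] i; rewrite hs //.
  move: (Sy0); rewrite inE => /asboolP[z [[Zz cz] bz]].
  have /andP[z1 z2] := bz i; have /andP[_ z3] := cz i.
  have j0 : 0 <= j0'%:R / M%:R * v 0 i by rewrite mulr_ge0 ?divr_ge0 // mxE.
  have j1 : j0'%:R / M%:R * v 0 i <= 1.
    rewrite mxE -[leRHS]mulr1 ler_pM ?divr_ge0 //; last by rewrite lern1 leq_b1.
    by rewrite ler_pdivrMr ?ltr0n // mul1r ler_nat ltnW.
  have c0 : - B%:R <= corner y0 0 i by rewrite mxE lerDl mulr_ge0 // ltW.
  by rewrite natrD; apply/andP; split; lra.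
(* double counting of the pairs of a translate and one of its cells *)
have cnt : (M * #|S| <= d * G.+1 ^ l)%N.
  have -> : (M * #|S| = \sum_(j < M) #|shift j @: S|)%N.
    under eq_bigr do rewrite card_in_imset //.
    by rewrite sum_nat_const card_ord.
  under eq_bigr do rewrite -sum1_card big_mkcond /=.
  rewrite exchange_big /=.
  apply: (@leq_trans (\sum_(y : {ffun 'I_l -> 'I_G.+1}) d)%N).
    apply: leq_sum => y _; rewrite -big_mkcond /= sum1_card; exact: fiber.
  by rewrite sum_nat_const card_ffun !card_ord mulnC.
have hG : G.+1%:R * h <= (2 * B + 2)%:R.
  rewrite /h ler_pdivrMr // -natrM ler_nat /G.
  by rewrite -addn1 [((2 * B + 2) * _)%N]mulnDl mulnDl -addnA leq_add2l mul1n mul2n -addnn leq_add2l.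
apply: (@le_trans _ _ (d%:R * (G.+1%:R * h) ^+ l)).
  rewrite exprMn !mulrA -natrX -!natrM; apply: ler_wpM2r.
    by rewrite exprn_ge0 // ltW.
  by rewrite ler_nat.
by rewrite ler_wpM2l // lerXn2r ?nnegrE // mulr_ge0 // ltW.
Qed.
End grid.

Section outer0.
Context (R : realType) (l : nat).

Lemma nneseries_padded (c : R) (N : nat) (f : nat -> R) : 0 <= c ->
  (forall k, f k = if (k < N)%N then c else 0) ->
  (\sum_(0 <= k <oo) (f k)%:E <= (N%:R * c)%:E)%E.
Proof.
move=> c0 hf; apply: lime_le.
  by apply: is_cvg_nneseries => k _ _; rewrite lee_fin hf; case: ifP.
near=> m; rewrite sumEFin lee_fin.
have -> : \sum_(0 <= k < m) f k = (minn m N)%:R * c.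
  elim: (m) => [|p IHp]; first by rewrite big_geq // min0n mul0r.
  rewrite big_nat_recr //= IHp hf; case: ltnP => pN.
    by rewrite (minn_idPl pN) -natr1 mulrDl mul1r.
  by rewrite (minn_idPr (leqW pN)) addr0.
by rewrite ler_wpM2r // ler_nat geq_minr.
Unshelve. all: by end_near. Qed.

(** Each bounded piece of [Z] is covered by cells of total volume at most
    [d * (2 * B + 2) ^ l / M], for every [M]. *)
Lemma lebesgue_outer_finite_lines (Z : set 'rV[R]_l) (vb : 'I_l -> bool) (d : nat) :
  (0 < l)%N -> closed Z ->
  (forall x, exists P : {poly R}, [/\ P != 0, (size P <= d.+1)%N &
     forall s, Z (x + s *: \row_i (vb i)%:R) -> root P s]) ->
  lebesgue_outer Z = 0%E.
Proof.
move=> l0 cZ hZ.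
have -> : Z = \bigcup_B (Z `&` @cube R l B%:R).
  apply/seteqP; split => [z Zz|z [B _ []] //].
  pose r := \sum_i `|z 0 i|.
  have r0 : 0 <= r by apply: sumr_ge0.
  exists (Num.bound r) => //; split => // i.
  have zr : `|z 0 i| <= (Num.bound r)%:R.
    apply: (le_trans _ (ltW (archi_boundP r0))).
    by rewrite /r (bigD1 i) //= lerDl; exact: sumr_ge0.
  by rewrite -ler_norml.
apply: lebesgue_outer_bigcup0 => B e e0.
pose C : R := d%:R * (2 * B + 2)%:R ^+ l.
have C0 : 0 <= C by rewrite mulr_ge0 // exprn_ge0.
pose M := (Num.bound (C / e)).+1.
have [G [h [S]]] := @grid_count R l Z vb d cZ hZ B M isT.
set corner := (fun y : {ffun _ -> _} => _) => /= -[h0 cov cnt].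
pose s := enum S.
(* the list of cells is padded with degenerate boxes, of volume [0] as [0 < l] *)
pose a k : 'rV[R]_l := if (k < size s)%N then corner (nth [ffun=> ord0] s k) else 0.
pose b k : 'rV[R]_l := if (k < size s)%N then a k + const_mx h else 0.
have ab k i : a k 0 i <= b k 0 i.
  by rewrite /b /a; case: ifP => // kS; rewrite [leRHS]mxE [const_mx h _ _]mxE lerDl ltW.
exists a, b; split; first split => //.
  move=> z /cov [y Sy bz]; exists (index y s) => //.
  have ys : y \in s by rewrite mem_enum.
  by rewrite /b /a index_mem ys nth_index.
have vol k : box_volume (a k) (b k) = if (k < size s)%N then h ^+ l else 0.
  rewrite /box_volume /b; case: ifP => kS.
    rewrite (eq_bigr (fun=> h)) ?prodr_const ?card_ord // => i _.
    by rewrite mxE [const_mx h _ _]mxE addrAC subrr add0r.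
  rewrite /a kS (bigD1 (Ordinal l0)) //= mxE subrr mul0r //.
apply: (le_trans (nneseries_padded (exprn_ge0 l (ltW h0)) vol)).
rewrite lee_fin /s -cardE.
have M0 : (0 : R) < M%:R by rewrite ltr0n.
rewrite -(ler_pM2l M0) (le_trans cnt) // -/C -ler_pdivrMr //.
rewrite ltW // (lt_le_trans (archi_boundP _)) ?divr_ge0 ?(ltW e0) //.
by rewrite ler_nat /M.
Qed.
End outer0.

(** * Leading coefficients along a line *)

Section leading.
Context (R : fieldType).
Implicit Types (p q : {poly R}) (e : nat) (c : R).

(** [c] may be [0]: leading terms can then be added and multiplied without
    knowing in advance that they do not cancel. *)
Definition lead_at e p c := (size p <= e.+1)%N /\ p`_e = c.

Lemma lead_atD e p q c c' : lead_at e p c -> lead_at e q c' -> lead_at e (p + q) (c + c').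
Proof.
move=> [sp <-] [sq <-]; split; last by rewrite coefD.
by rewrite (leq_trans (size_polyD _ _)) // geq_max sp sq.
Qed.

Lemma lead_atM e e' p q c c' : lead_at e p c -> lead_at e' q c' ->
  lead_at (e + e') (p * q) (c * c').
Proof.
move=> [sp <-] [sq <-]; split.
  apply: (leq_trans (size_polyMleq _ _)).
  by have := leq_add sp sq; rewrite addSn addnS; case: (_ + _)%N.
rewrite coefM (bigD1 (Ordinal (leq_addr e' e : e < (e + e').+1)%N)) //= addKn.
rewrite big1 ?addr0 // => i /eqP/val_eqP /= ie.
have [ei|ei|/eqP] := ltngtP e i; last by rewrite eq_sym (negbTE ie).
  by rewrite nth_default ?mul0r // (leq_trans sp).
rewrite [q`__]nth_default ?mulr0 // (leq_trans sq) //.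
by move: ei; lia.
Qed.

Lemma lead_at_sum (I : Type) (r : seq I) (P : pred I) e (p : I -> {poly R}) (c : I -> R) :
  (forall i, P i -> lead_at e (p i) (c i)) ->
  lead_at e (\sum_(i <- r | P i) p i) (\sum_(i <- r | P i) c i).
Proof.
move=> h; apply: (big_rec2 (fun p c => lead_at e p c)).
  by split; rewrite ?size_poly0 ?coef0.
by move=> i x y Pi hxy; apply: lead_atD => //; exact: h.
Qed.

Lemma lead_at_prod (I : Type) (r : seq I) (P : pred I) (e : I -> nat)
    (p : I -> {poly R}) (c : I -> R) :
  (forall i, P i -> lead_at (e i) (p i) (c i)) ->
  lead_at (\sum_(i <- r | P i) e i) (\prod_(i <- r | P i) p i) (\prod_(i <- r | P i) c i).
Proof.
move=> h; apply: (big_rec3 (fun e p c => lead_at e p c)).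
  by split; rewrite ?size_poly1 ?coef1.
by move=> i x y z Pi hxy; apply: lead_atM => //; exact: h.
Qed.

Lemma lead_at_det n (e : 'I_n -> nat) (M : 'M[{poly R}]_n) (C : 'M[R]_n) :
  (forall i j, lead_at (e i) (M i j) (C i j)) ->
  lead_at (\sum_i e i) (\det M) (\det C).
Proof.
move=> h; apply: lead_at_sum => s _; rewrite -[X in lead_at X]add0n.
apply: lead_atM; last by apply: lead_at_prod.
by case: (odd_perm s); rewrite ?expr0 ?expr1; split;
  rewrite ?size_polyN ?size_poly1 ?coefN ?coef1.
Qed.

Lemma lead_at_mulmx e e' m n k
    (A : 'M[{poly R}]_(m, n)) (B : 'M[{poly R}]_(n, k)) (A0 : 'M[R]_(m, n)) (B0 : 'M[R]_(n, k)) :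
  (forall i j, lead_at e (A i j) (A0 i j)) ->
  (forall i j, lead_at e' (B i j) (B0 i j)) ->
  forall i j, lead_at (e + e') ((A *m B) i j) ((A0 *m B0) i j).
Proof.
move=> hA hB i j; rewrite !mxE; apply: lead_at_sum => l _; exact: lead_atM.
Qed.

Lemma lead_at_expmx n (A : 'M[{poly R}]_n) (A0 : 'M[R]_n) k :
  (forall i j, lead_at 1 (A i j) (A0 i j)) ->
  forall i j, lead_at k ((A ^+ k) i j) ((A0 ^+ k) i j).
Proof.
move=> hA; elim: k => [|k IHk] i j.
  by rewrite !expr0 !mxE; case: (i == j); split; rewrite ?size_poly1 ?size_poly0 ?coef1 ?coef0.
by rewrite !exprS -add1n; apply: lead_at_mulmx.
Qed.

(** The line through [A] with direction [A0], as a matrix over [{poly R}]. *)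
Definition line_mx m n (A A0 : 'M[R]_(m, n)) : 'M[{poly R}]_(m, n) :=
  \matrix_(i, j) ((A i j)%:P + A0 i j *: 'X).

Lemma lead_at_line m n (A A0 : 'M[R]_(m, n)) i j : lead_at 1 (line_mx A A0 i j) (A0 i j).
Proof.
rewrite mxE; split; last by rewrite coefD coefC coefZ coefX mulr1 add0r.
rewrite (leq_trans (size_polyD _ _)) // geq_max size_polyC.
rewrite (leq_trans (size_scale_leq _ _)) ?size_polyX //.
by case: (_ != 0).
Qed.

Lemma horner_line m n (A A0 : 'M[R]_(m, n)) s :
  map_mx (horner_eval s) (line_mx A A0) = A + s *: A0.
Proof.
by apply/matrixP => i j; rewrite !mxE /horner_eval !hornerE mulrC.
Qed.

Lemma map_expmx (S : comNzRingType) n (f : {rmorphism {poly R} -> S}) (A : 'M[{poly R}]_n) k :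
  map_mx f (A ^+ k) = map_mx f A ^+ k.
Proof.
elim: k => [|k IHk]; first by rewrite !expr0; exact: map_mx1.
by rewrite !exprS -IHk; exact: map_mxM.
Qed.

Lemma horner_obsv n (A A0 : 'M[R]_n) (c c0 : 'rV[R]_n) s :
  (\det (obsv (line_mx A A0) (line_mx c c0))).[s] = \det (obsv (A + s *: A0) (c + s *: c0)).
Proof.
rewrite -[LHS]/(horner_eval s _) -det_map_mx; congr (\det _).
apply/matrixP => i j; rewrite 2!mxE [RHS]mxE -!horner_line -map_expmx -map_mxM.
by rewrite [RHS]mxE.
Qed.

Lemma horner_ctrb n (A A0 : 'M[R]_n) (b b0 : 'cV[R]_n) s :
  (\det (ctrb (line_mx A A0) (line_mx b b0))).[s] = \det (ctrb (A + s *: A0) (b + s *: b0)).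
Proof.
rewrite -[LHS]/(horner_eval s _) -det_map_mx; congr (\det _).
apply/matrixP => i j; rewrite 2!mxE [RHS]mxE -!horner_line -map_expmx -map_mxM.
by rewrite [RHS]mxE.
Qed.

Lemma lead_at_obsv n (A A0 : 'M[R]_n) (c c0 : 'rV[R]_n) :
  lead_at (\sum_(i < n) i.+1) (\det (obsv (line_mx A A0) (line_mx c c0)))
    (\det (obsv A0 c0)).
Proof.
apply: lead_at_det => i j; rewrite ![obsv _ _ _ _]mxE -add1n.
by apply: lead_at_mulmx; [exact: lead_at_line|apply: lead_at_expmx; exact: lead_at_line].
Qed.

Lemma lead_at_ctrb n (A A0 : 'M[R]_n) (b b0 : 'cV[R]_n) :
  lead_at (\sum_(i < n) i.+1) (\det (ctrb (line_mx A A0) (line_mx b b0)))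
    (\det (ctrb A0 b0)).
Proof.
rewrite -det_tr -[X in lead_at _ _ X]det_tr.
apply: lead_at_det => i j; rewrite ![_^T _ _]mxE ![ctrb _ _ _ _]mxE -addn1.
by apply: lead_at_mulmx; [apply: lead_at_expmx|]; exact: lead_at_line.
Qed.
End leading.

Section shift_chain.
Context (R : fieldType) (n : nat).

(** A chain of integrators is observable from its first state and
    controllable through its last one. *)
Definition shift_mx : 'M[R]_n := \matrix_(i, j) (j == i.+1 :> nat)%:R.
Definition first_row : 'rV[R]_n := \row_j (j == 0%N :> nat)%:R.
Definition last_col : 'cV[R]_n := \col_i (i.+1 == n)%:R.

Lemma obsv_shift : obsv shift_mx first_row = 1%:M.
Proof.
have h k j : (first_row *m shift_mx ^+ k) 0 j = (j == k :> nat)%:R.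
  elim: k j => [|k IHk] j; first by rewrite expr0 mulmx1 mxE.
  rewrite exprSr mulmxA mxE.
  under eq_bigr do rewrite IHk mxE.
  have [kn|nk] := ltnP k n.
    rewrite (bigD1 (Ordinal kn)) //= eqxx mul1r big1 ?addr0 // => i.
    by move=> /eqP/val_eqP /= /negbTE ->; rewrite mul0r.
  rewrite big1 => [|i _].
    by rewrite ltn_eqF // (leq_trans (ltn_ord j)) // leqW.
  by rewrite ltn_eqF ?mul0r // (leq_trans (ltn_ord i)).
by apply/matrixP => i j; rewrite mxE h [RHS]mxE eq_sym.
Qed.

Lemma ctrb_shift_unit : ctrb shift_mx last_col \in unitmx.
Proof.
have h k i : (shift_mx ^+ k *m last_col) i 0 = (i + k.+1 == n)%N%:R.
  elim: k i => [|k IHk] i; first by rewrite expr0 mul1mx mxE addn1.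
  rewrite exprS -mulmxA mxE.
  under eq_bigr do rewrite IHk mxE.
  have [kn|nk] := ltnP i.+1 n.
    rewrite (bigD1 (Ordinal kn)) //= eqxx mul1r big1 ?addr0 => [|j].
      by rewrite addSnnS.
    by move=> /eqP/val_eqP /= /negbTE ->; rewrite mul0r.
  rewrite big1 => [|j _].
    by rewrite (_ : (_ == n) = false) //; apply/negbTE; lia.
  by rewrite ltn_eqF ?mul0r // (leq_trans (ltn_ord j)).
(* the controllability matrix reverses the order of the basis *)
rewrite (_ : ctrb _ _ = perm_mx (perm (@rev_ord_inj n))); first exact: unitmx_perm.
apply/matrixP => i j; rewrite mxE h [RHS]mxE [RHS]mxE permE.
congr (nat_of_bool _)%:R; apply/eqP/eqP => [e|<- /=].
  apply: val_inj => /=; lia.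
by have := ltn_ord i; lia.
Qed.
End shift_chain.

(** * Genericity of minimal systems *)

Section genericity.
Context (R : realType) (n : nat).

Definition coords_sys (x : 'rV[R]_((n * n + n * n) + (n + n))) : bilinear_sys R n :=
  BilinearSys (vec_mx (lsubmx (lsubmx x))) (vec_mx (rsubmx (lsubmx x)))
    (lsubmx (rsubmx x))^T (rsubmx (rsubmx x)).

Lemma sys_coordsK : cancel (@sys_coords R n) coords_sys.
Proof.
by case=> A N b c; rewrite /coords_sys /sys_coords /= !(row_mxKl, row_mxKr) !mxvecK trmxK.
Qed.

Lemma coords_sysK : cancel coords_sys (@sys_coords R n).
Proof.
by move=> x; rewrite /sys_coords /= !vec_mxK trmxK !hsubmxK.
Qed.

(** Nonzero exactly when [(A, c)] is observable and [(A + alpha N, b)] is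
    controllable. *)
Definition min_det (alpha : R) (s : bilinear_sys R n) : R :=
  \det (obsv (sysA s) (sysc s)) * \det (ctrb (sysA s + alpha *: sysN s) (sysb s)).

Lemma min_det_neq0 alpha s : min_det alpha s != 0 ->
  obsv (sysA s) (sysc s) \in unitmx /\
  ctrb (sysA s + alpha *: sysN s) (sysb s) \in unitmx.
Proof. by rewrite mulf_eq0 negb_or !unitmxE !unitfE => /andP. Qed.

Section rank_conditions.
Context (T : topologicalType).

Lemma continuous_obsv p (A : T -> 'M[R]_p) (c : T -> 'rV[R]_p) :
  continuous A -> continuous c -> continuous (fun x => obsv (A x) (c x)).
Proof.
move=> cA cc; apply: continuous_mx_entries => i j.
rewrite (_ : (fun x => _) = (fun x => (c x *m A x ^+ i) 0 j)); last first.
  by apply/funext => x; rewrite mxE.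
apply: (@coord_comp_continuous _ _ _ _ (fun x => c x *m A x ^+ i)).
by apply: continuous_mulmx => //; exact: continuous_expmx.
Qed.

Lemma continuous_ctrb p (A : T -> 'M[R]_p) (b : T -> 'cV[R]_p) :
  continuous A -> continuous b -> continuous (fun x => ctrb (A x) (b x)).
Proof.
move=> cA cc; apply: continuous_mx_entries => i j.
rewrite (_ : (fun x => _) = (fun x => (A x ^+ j *m b x) i 0)); last first.
  by apply/funext => x; rewrite mxE.
apply: (@coord_comp_continuous _ _ _ _ (fun x => A x ^+ j *m b x)).
by apply: continuous_mulmx => //; exact: continuous_expmx.
Qed.

End rank_conditions.

Lemma min_det_continuous alpha : continuous (fun x => min_det alpha (coords_sys x)).
Proof.
have cA : continuous (fun x => sysA (coords_sys x)).
  apply: continuous_mx_entries => i j.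
  rewrite (_ : (fun x => _) = (fun x : 'rV[R]_((n * n + n * n) + (n + n)) =>
     x 0 (lshift _ (lshift _ (mxvec_index i j))))); first exact: coord_continuous.
  by apply/funext => x; rewrite !mxE.
have cN : continuous (fun x => sysN (coords_sys x)).
  apply: continuous_mx_entries => i j.
  rewrite (_ : (fun x => _) = (fun x : 'rV[R]_((n * n + n * n) + (n + n)) =>
     x 0 (lshift _ (rshift _ (mxvec_index i j))))); first exact: coord_continuous.
  by apply/funext => x; rewrite !mxE.
have cb : continuous (fun x => sysb (coords_sys x)).
  apply: continuous_mx_entries => i j.
  rewrite (_ : (fun x => _) = (fun x : 'rV[R]_((n * n + n * n) + (n + n)) =>
     x 0 (rshift _ (lshift _ i)))); first exact: coord_continuous.
  by apply/funext => x; rewrite !mxE ord1.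
have cc : continuous (fun x => sysc (coords_sys x)).
  apply: continuous_mx_entries => i j.
  rewrite (_ : (fun x => _) = (fun x : 'rV[R]_((n * n + n * n) + (n + n)) =>
     x 0 (rshift _ (rshift _ j)))); first exact: coord_continuous.
  by apply/funext => x; rewrite !mxE ord1.
have cF : continuous (fun x => sysA (coords_sys x) + alpha *: sysN (coords_sys x)).
  exact: continuous_addZ.
apply: continuous_mulfun.
  exact: (continuous_det (continuous_obsv cA cc)).
exact: (continuous_det (continuous_ctrb cF cb)).
Qed.

(** The direction of the lines along which [min_det] is studied: here
    [min_det] is nonzero, and the coordinates are [0] or [1]. *)
Definition ref_sys : bilinear_sys R n :=
  BilinearSys (shift_mx R n) 0 (last_col R n) (first_row R n).

Lemma ref_sys_coords : exists vb, sys_coords ref_sys = \row_i (vb i : bool)%:R.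
Proof.
exists (fun i => sys_coords ref_sys 0 i != 0); apply/rowP => i; rewrite [RHS]mxE.
have bE (b : bool) : (b%:R : R) = ((b%:R : R) != 0)%:R.
  by case: b; rewrite ?oner_eq0 ?eqxx.
rewrite /sys_coords /=; case: (split_ordP i) => j ->; rewrite ?row_mxEl ?row_mxEr.
  case: (split_ordP j) => k ->; rewrite ?row_mxEl ?row_mxEr.
    by case/mxvec_indexP: k => a b; rewrite mxvecE mxE.
  by case/mxvec_indexP: k => a b; rewrite mxvecE mxE eqxx.
by case: (split_ordP j) => k ->; rewrite ?row_mxEl ?row_mxEr ?mxE.
Qed.

(** The entries of row [i] of the observability matrix and of column [i] of the
    controllability matrix are homogeneous of degree [i.+1], so the coefficient
    of [s] in the top degree is [min_det] of the direction. *)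
Lemma min_det_line alpha x : exists P : {poly R},
  [/\ P != 0, (size P <= (2 * \sum_(i < n) i.+1).+1)%N &
   forall s, P.[s] = min_det alpha (coords_sys (x + s *: sys_coords ref_sys))].
Proof.
pose S := coords_sys x; pose F := sysA S + alpha *: sysN S.
pose P := \det (obsv (line_mx (sysA S) (shift_mx R n)) (line_mx (sysc S) (first_row R n))) *
  \det (ctrb (line_mx F (shift_mx R n)) (line_mx (sysb S) (last_col R n))).
have [szP lP] : lead_at (\sum_(i < n) i.+1 + \sum_(i < n) i.+1) P
    (\det (obsv (shift_mx R n) (first_row R n)) * \det (ctrb (shift_mx R n) (last_col R n))).
  by apply: lead_atM; [exact: lead_at_obsv|exact: lead_at_ctrb].
exists P; split.
- apply/eqP => P0; move: lP; rewrite P0 coef0 => /esym/eqP; apply/negP.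
  by rewrite obsv_shift det1 mul1r -unitfE -unitmxE ctrb_shift_unit.
- by rewrite mul2n -addnn.
move=> s; rewrite hornerM horner_obsv horner_ctrb /min_det.
have lin (m1 m2 : nat) (u w : 'rV[R]_(m1 + m2)) : lsubmx (u + s *: w) = lsubmx u + s *: lsubmx w.
  by rewrite linearD linearZ.
have lir (m1 m2 : nat) (u w : 'rV[R]_(m1 + m2)) : rsubmx (u + s *: w) = rsubmx u + s *: rsubmx w.
  by rewrite linearD linearZ.
have -> : coords_sys (x + s *: sys_coords ref_sys) =
  BilinearSys (sysA S + s *: shift_mx R n) (sysN S) (sysb S + s *: last_col R n)
   (sysc S + s *: first_row R n).
  rewrite /coords_sys !(lin, lir) /sys_coords !(row_mxKl, row_mxKr) /=.
  congr BilinearSys.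
  - by rewrite linearD linearZ /= mxvecK.
  - by rewrite linearD linearZ /= mxvecK scaler0 addr0.
  - by rewrite linearD linearZ /= trmxK.
by rewrite /= addrAC.
Qed.

Definition minimal_sys (alpha : R) : set (bilinear_sys R n) :=
  [set s | min_det alpha s != 0].

Lemma minimal_sys_coords alpha :
  @sys_coords R n @` minimal_sys alpha = [set x | min_det alpha (coords_sys x) != 0].
Proof.
apply/seteqP; split => [_ [s ms <-]|x mx]; first by rewrite /= sys_coordsK.
by exists (coords_sys x) => //; rewrite coords_sysK.
Qed.

Lemma generic_minimal_sys alpha : (0 < n)%N -> generic_sys (minimal_sys alpha).
Proof.
move=> n0; rewrite /generic_sys minimal_sys_coords.
set X := [set x | _].
have oX : open X.
  apply: (@open_comp _ _ (fun x => min_det alpha (coords_sys x)) [set r | r != 0]).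
    by move=> x _; exact: min_det_continuous.
  exact: open_neq.
have [vb hvb] := ref_sys_coords.
split => //.
- move=> O [x Ox] oO.
  have [P [P0 _ hP]] := min_det_line alpha x.
  have cl : continuous (fun s : R => x + s *: sys_coords ref_sys).
    apply: continuous_mx_entries => i j.
    rewrite (_ : (fun s => _) = (fun s : R => x i j + s * sys_coords ref_sys i j)).
      by move=> s; apply: cvgD; [exact: cvg_cst|apply: cvgMr_tmp; exact: cvg_id].
    by apply/funext => s; rewrite !mxE.
  have : nbhs (0 : R) [set s | O (x + s *: sys_coords ref_sys)].
    apply: cl; rewrite scale0r addr0; exact: open_nbhs_nbhs.
  move=> /nbhs_ballP[e /= e0 he].
  (* more points near [x] on the line than the polynomial has roots *)
  pose rs := [seq e / k.+2%:R | k <- iota 0 (size P)].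
  have urs : uniq rs.
    rewrite map_inj_in_uniq ?iota_uniq // => k1 k2 _ _.
    move=> /(mulfI (lt0r_neq0 e0)) /invr_inj /eqP; rewrite eqr_nat => /eqP.
    by case.
  have : ~~ all (root P) rs.
    apply/negP => ars; have := max_poly_roots P0 ars urs.
    by rewrite size_map size_iota ltnn.
  rewrite -has_predC => /hasP[_ /mapP[k _ ->] /= nroot].
  exists (x + (e / k.+2%:R) *: sys_coords ref_sys); split.
    apply: he; rewrite /ball /= sub0r normrN ger0_norm ?divr_ge0 ?ltW //.
    by rewrite ltr_pdivrMr // ltr_pMr // ltr1n.
  by rewrite /X /= -hP.
- apply: (@lebesgue_outer_finite_lines R _ _ vb (2 * \sum_(i < n) i.+1)).
  + by rewrite !addn_gt0 n0 !orbT.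
  + exact: open_closedC.
  + move=> x; have [P [P0 szP hP]] := min_det_line alpha x.
    exists P; split => // s; rewrite -hvb /X /= => /negP.
    by rewrite negbK -hP.
Qed.
End genericity.

Theorem theorem3 (R : realType) (n : nat) (n_gt0 : (0 < n)%N) (alpha : R)
    (alpha_neq0 : alpha <> 0) :
  exists M : set (bilinear_sys R n), generic_sys M /\
    forall s1 s2 : bilinear_sys R n, M s1 -> M s2 ->
      (io_equiv_wrt (pulses alpha) s1 s2 <-> io_equiv s1 s2).
Proof.
exists (minimal_sys alpha); split; first exact: generic_minimal_sys.
move=> s1 s2 /min_det_neq0[uO1 uK1] /min_det_neq0[uO2 uK2]; split.
  exact: pulse_equiv_io_equiv.
by move=> h u pu; apply: h; exact: (@pulses_inputs R alpha).
Qed.
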